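(* Let $r$ be a prime power and $q$ a power of $r$. For $i\in\mathbb{N}$ let $$C_i=\{(a,b)\in\mathbb{F}_q^2:\ x^{r^2}+ax^r+bx \text{ has a maximal } i\text{-collision in } \mathbb{F}_q[x;r]\},\qquad c_i=\#C_i,$$ and identify $(a,b)$ with the polynomial $f=x^{r^2}+ax^r+bx$. Let $f^*$ denote the minimal central left composition of $f$. Then the following hold. (Case 0) $C_0$ is the set of all monic $f\in\mathbb{F}_q[x;r]$ of degree $r^2$ for which $f^*\in\mathbb{F}_r[x;q]$ has degree $q^2$ and cannot be written as $f^*=g^*\circ h^*$ with $g^*,h^*\in\mathbb{F}_r[x;q]$ of degree $q$; equivalently, $\tau(f^* )\in\mathbb{F}_r[y]$ is irreducible of degree $2$. Moreover $$c_0=\frac{r(q^2-1)}{2(r+1)}.$$ (Case 1) $C_1$ is the set of all monic $f\in\mathbb{F}_q[x;r]$ of degree $r^2$ with $f^*=g^*\circ g^*$ for $g^*=x^q-cx$ with some $c\in\mathbb{F}_r^\times$. Moreover $$c_1=\frac{q^2-q}{r}+1.$$ (Case 2) $C_2$ is the set of all monic $f\in\mathbb{F}_q[x;r]$ of degree $r^2$ with $f^*=g^*\circ h^*$ for some $g^*,h^*\in\mathbb{F}_r[x;q]$ of degree $q$ with $\gcd(g^*,h^* )=1$. Moreover $$c_2=\frac{(q-1)^2(r-2)}{2(r-1)}+q-1.$$ (Case $r+1$) $C_{r+1}$ is the set of all monic $f\in\mathbb{F}_q[x;r]$ of degree $r^2$ with $f^*=x^q+cx$ for some $c\in\mathbb{F}_r^\times$.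 Moreover $$c_{r+1}=\frac{(q-1)(q-r)}{r(r^2-1)}.$$ Since $c_0+c_1+c_2+c_{r+1}=q^2$, these are the only possible numbers of collisions of a monic polynomial of degree $r^2$ in $\mathbb{F}_q[x;r]$ (i.e. $C_i=\emptyset$ for $i\notin\{0,1,2,r+1\}$).
   Context: $\mathbb{F}_q[x;r]=\{\sum_{0\le i\le n}a_ix^{r^i}: n\ge 0,\ a_i\in\mathbb{F}_q\}$ is the ring (under addition and composition) of $r$-additive polynomials over $\mathbb{F}_q$. Its centre is $\mathbb{F}_r[x;q]=\{\sum_{0\le i\le\kappa}a_ix^{q^i}:\kappa\ge 0,\ a_i\in\mathbb{F}_r\}$, which is isomorphic to $\mathbb{F}_r[y]$ (usual addition and multiplication) via $\tau(\sum a_ix^{q^i})=\sum a_iy^i$. The minimal central left composition $f^*$ of a nonzero $f\in\mathbb{F}_q[x;r]$ is the nonzero monic polynomial in $\mathbb{F}_r[x;q]$ of minimal degree such that $f^*=g\circ f$ for some $g\in\mathbb{F}_q[x;r]$. The condition $\gcd(g^*,h^* )=1$ is understood in the ring $\mathbb{F}_r[x;q]\cong\mathbb{F}_r[y]$, i.e. $\tau(g^* )$ and $\tau(h^* )$ are coprime. An $i$-collision is a set of $i$ distinct pairs $(g,h)$ of monic polynomials in $\mathbb{F}_q[x;r]$, here with $\deg g=\deg h=r$, all with the same composition $f=g\circ h$; it is maximal if it is not contained in an $(i+1)$-collision. Thus $f$ has a maximal $i$-collision iff it has exactly $i$ such decompositions.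
   Formalization: In Case 1 the polynomial f = x^(r^2), i.e. (a,b) = (0,0), is added to the description of C_1: it has exactly one decomposition x^r∘x^r, but f* is not of the form g*∘g* with c nonzero; c_1 is as printed and already counts it. *)

(* Defs.v *)
From HB Require Import structures.
From mathcomp Require Import all_boot all_order all_algebra.
From mathcomp Require Import finmap boolp classical_sets.

Set Implicit Arguments.
Unset Strict Implicit.
Unset Printing Implicit Defensive.

Import GRing.Theory.
Local Open Scope ring_scope.

(* [Fr] and [Fq] are finite fields with r and q elements, and [iota] is the
   inclusion of Fr in Fq.  Every prime power r and every power q of r arises in
   this way, and no other pair (r, q) does.  Degrees are [size p = n.+1]. *)

Section AdditivePolynomials.
Variables (Fr Fq : finFieldType) (iota : {rmorphism Fr -> Fq}) (r q : nat).
Implicit Types (f g h : {poly Fq}).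

(* f \in F_q[x;r] *)
Definition additive_poly f : Prop :=
  exists (n : nat) (a : nat -> Fq), f = \sum_(i < n.+1) a i *: 'X^(r ^ i).

(* f \in F_r[x;q] *)
Definition central_poly f : Prop :=
  exists (n : nat) (a : nat -> Fr),
    f = \sum_(i < n.+1) iota (a i) *: 'X^(q ^ i).

(* The element of Fr mapped to x by iota; 0 if there is none. *)
Definition iota_inv (x : Fq) : Fr := odflt 0 [pick a | iota a == x].

(* \sum_i a_i x^(q^i) |-> \sum_i a_i y^i, with coefficients read back in Fr;
   meaningful on F_r[x;q] only, see [tauE].  The bound [size f] suffices since
   i < q ^ i. *)
Definition tau f : {poly Fr} := \poly_(i < size f) iota_inv f`_(q ^ i).

Definition is_central_left_composition f F : Prop :=
  [/\ central_poly F, F \is monic & exists g, additive_poly g /\ F = g \Po f].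

Definition is_min_central_left_composition f F : Prop :=
  is_central_left_composition f F /\
  forall G, is_central_left_composition f G -> (size F <= size G)%N.

(* f^*; such a polynomial exists and is unique for nonzero f in F_q[x;r]. *)
Definition min_central f : {poly Fq} :=
  xget 0 (is_min_central_left_composition f).

Local Open Scope fset_scope.

(* For every i, and in particular i = 0, the common composition f is fixed. *)
Definition collision (i : nat) f (S : {fset {poly Fq} * {poly Fq}}) : Prop :=
  #|` S| = i /\
  forall g h, (g, h) \in S ->
    [/\ additive_poly g, g \is monic & size g = r.+1] /\
    [/\ additive_poly h, h \is monic & size h = r.+1] /\
    g \Po h = f.

Definition has_maximal_collision (i : nat) f : Prop :=
  exists S, collision i f S /\
    ~ exists T, collision i.+1 f T /\ S `<=` T.

Definition fab (a b : Fq) : {poly Fq} := 'X^(r ^ 2) + a *: 'X^r + b *: 'X.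

Definition collision_set (i : nat) : {set Fq * Fq} :=
  finset (fun ab => `[< has_maximal_collision i (fab ab.1 ab.2) >]).

Lemma tauE (n : nat) (a : nat -> Fr) : (1 < q)%N ->
  tau (\sum_(i < n) iota (a i) *: 'X^(q ^ i)) = \poly_(i < n) a i.
Proof.
move=> q_gt1; set f := \sum_(_ < _) _.
have invK c : iota_inv (iota c) = c.
  rewrite /iota_inv; case: pickP => [d /eqP /fmorph_inj // | /(_ c)].
  by rewrite eqxx.
have coef_f i : f`_(q ^ i) = if (i < n)%N then iota (a i) else 0.
  rewrite /f coef_sum; case: ltnP => [lt_in|le_ni].
    rewrite (bigD1 (Ordinal lt_in)) //= coefZ coefXn eqxx mulr1 big1 ?addr0 //.
    move=> j ne_ji; rewrite coefZ coefXn eqn_exp2l // eq_sym.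
    by rewrite (negPf (_ : j != i :> nat)) ?mulr0.
  rewrite big1 // => j _; rewrite coefZ coefXn eqn_exp2l //.
  by rewrite gtn_eqF ?mulr0 // (leq_trans _ le_ni).
apply/polyP=> i; rewrite !coef_poly coef_f.
case: (ltnP i n) => lt_in; last first.
  by case: ifP => // _; rewrite -(rmorph0 iota) invK.
rewrite invK; case: ltnP => // le_fi; apply: (fmorph_inj iota).
rewrite rmorph0; have := coef_f i; rewrite lt_in => <-.
by rewrite nth_default // (leq_trans le_fi) // ltnW // ltn_expl.
Qed.

End AdditivePolynomials.

(* Main.v *)
Require Import Defs.
From mathcomp Require Import all_boot all_order all_algebra.
From mathcomp Require Import finmap boolp classical_sets.
From mathcomp Require Import fingroup cyclic pgroup abelian finfield ring zify.

Set Implicit Arguments.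
Unset Strict Implicit.
Unset Printing Implicit Defensive.

Import GRing.Theory.
Local Open Scope ring_scope.

(** A right component X^r - vX of f = X^(r^2) + aX^r + bX corresponds to a root
    v in F_q of P = Y^(r+1) + aY + b, so the number of decompositions of f is the
    number of roots of P in F_q.  Modulo X^r - vX the central element X^q acts as
    the norm N(v) of v, so X^r - vX divides F in F_r[x;q] iff N(v) is a root of
    tau(F).  Conversely f divides a central polynomial whose tau-image is
    quadratic, and from a factorization (y - c)(y - c') of tau(f^* ) one gets a
    root of P of norm c'.  If tau(f^* ) = y - c with c <> 0, then P divides
    Y^((q-1)/(r-1)) - c, which splits with simple roots, and P has r + 1 roots.
    Thus the shape of tau(f^* ) determines the number of roots.

    For the counts, two distinct elements of F_q are roots of exactly one P, and
    they have distinct norms iff P has exactly two roots.  Counting roots, pairs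
    of distinct roots and pairs with distinct norms over all (a, b) gives linear
    equations for the c_i. *)

(** * Auxiliary facts on finite sets and polynomials *)

(** One-way implications suffice for a classification: the alternatives are exhaustive and the four
    values are pairwise distinct, so the value identifies the alternative. *)
Lemma iff_partition (n n0 n1 n2 n3 : nat) (P0 P1 P2 P3 : Prop) :
    (P0 -> n = n0) -> (P1 -> n = n1) -> (P2 -> n = n2) -> (P3 -> n = n3) ->
    n0 <> n1 -> n0 <> n2 -> n1 <> n2 -> n3 <> n0 -> n3 <> n1 -> n3 <> n2 ->
    [\/ P0, P1, P2 | P3] ->
  [/\ n = n0 <-> P0, n = n1 <-> P1, n = n2 <-> P2 & n = n3 <-> P3].
Proof.
by move=> k0 k1 k2 k3 n01 n02 n12 n30 n31 n32 [] p;
  split; split=> // e; intuition congruence.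
Qed.

Lemma card_distinct_pairs (T : finType) (A : {set T}) :
  #|[set p : T * T | [&& p.1 != p.2, p.1 \in A & p.2 \in A]]%SET|
    = (#|A| * #|A|.-1)%N.
Proof.
rewrite -sum1dep_card.
transitivity (\sum_(u in A) \sum_(v in A :\ u) 1)%N.
  rewrite pair_big_dep /=; apply: eq_bigl => -[u v] /=.
  by rewrite finset.in_setD1 eq_sym; case: (u \in A); rewrite ?andbF.
rewrite -sum_nat_const; apply: eq_bigr => u Au.
by rewrite sum1_card (cardsD1 u A) Au.
Qed.

Lemma size2_XsubC (F : fieldType) (s : {poly F}) :
  size s = 2%N -> exists c, s = lead_coef s *: ('X - c%:P).
Proof.
move=> sz_s; have nz_l : lead_coef s != 0.
  by rewrite lead_coef_eq0 -size_poly_eq0 sz_s.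
exists (- s`_0 / lead_coef s).
rewrite scalerBr -(mul_polyC _ _%:P) -polyCM mulrC divfK // polyCN opprK.
apply/polyP=> i; rewrite coefD coefZ coefX coefC lead_coefE sz_s.
case: i => [|[|i]] /=; rewrite ?mulr0 ?mulr1 ?add0r ?addr0 //.
by rewrite nth_default // sz_s.
Qed.

Lemma size_mul_XsubC (F : idomainType) (c c' : F) :
  size (('X - c%:P) * ('X - c'%:P)) = 3%N.
Proof. by rewrite size_monicM ?monicXsubC ?polyXsubC_eq0 // !size_XsubC. Qed.

(** Substituting X^k multiplies degrees by k, so a nonzero remainder R of Q by P would give a
    nonzero multiple R(X^k) of P(X^k) of smaller degree. *)
Lemma dvdp_comp_Xn (F : fieldType) (P Q : {poly F}) k :
  (0 < k)%N -> P != 0 -> P \Po 'X^k %| Q \Po 'X^k -> P %| Q.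
Proof.
move=> k_gt0 nz_P; rewrite {1}(divp_eq Q P) comp_polyD comp_polyM.
rewrite dvdp_addr ?dvdp_mulIr // /dvdp; set R := Q %% P => dv.
apply: contraT => nz_R.
have Xk_gt1 : (1 < size ('X^k : {poly F})%R)%N by rewrite size_polyXn ltnS.
have nz_Rk : R \Po 'X^k != 0 by rewrite comp_poly_eq0.
have := dvdp_leq nz_Rk dv; rewrite -[(_ <= _)%N]ltnS.
have size_comp (S : {poly F}) : S != 0 ->
    size (S \Po 'X^k) = ((size S).-1 * k).+1.
  move=> nz_S; have := size_comp_poly S 'X^k; rewrite size_polyXn /= => <-.
  by rewrite prednK // lt0n size_poly_eq0 comp_poly_eq0.
rewrite !size_comp // !ltnS leq_pmul2r // leqNgt => /negP[].
by rewrite -ltnS !prednK ?lt0n ?size_poly_eq0 // ltn_modp.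
Qed.

Lemma expf_card1 (F : finFieldType) (x : F) : x != 0 -> x ^+ #|F|.-1 = 1.
Proof.
move=> nz_x; apply: (mulfI nz_x).
by rewrite -exprS (ltn_predK (finNzRing_gt1 F)) expf_card mulr1.
Qed.

Lemma pnat_card_finField (F : finFieldType) p :
  p \in [pchar F] -> (p.-nat #|F|)%N.
Proof.
by move=> /fin_ring_pchar_abelem /abelem_pgroup; rewrite /pgroup cardsT.
Qed.

(** * Cardinalities of finite fields *)

Section FieldExtensionCard.
Variables (Fr Fq : finFieldType) (iota : {rmorphism Fr -> Fq}).

(** A generator of the unit group of [Fr] keeps its order r - 1 under [iota], and every unit of [Fq]
    has order dividing q - 1. *)
Lemma card_predn_dvd : (#|Fr|.-1 %| #|Fq|.-1)%N.
Proof.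
have r_gt1 := finNzRing_gt1 Fr.
have r1_gt0 : (0 < #|Fr|.-1)%N by case: #|Fr| r_gt1 => [|[]].
set rs := enum (predC1 (0 : Fr)).
have size_rs : size rs = #|Fr|.-1 by rewrite -cardE cardC1.
have all_rs : all #|Fr|.-1.-unity_root rs.
  by apply/allP=> x; rewrite mem_enum unity_rootE => /expf_card1->.
have /hasP[z _ prim_z] : has #|Fr|.-1.-primitive_root rs.
  by apply: has_prim_root; rewrite ?enum_uniq ?size_rs.
rewrite -(fmorph_primitive_root iota) in prim_z.
rewrite (prim_order_dvd prim_z) expf_card1 //.
apply/eqP=> z0; have := prim_expr_order prim_z.
by rewrite z0 expr0n -leqn0 leqNgt r1_gt0 => /eqP; rewrite eq_sym oner_eq0.
Qed.

Lemma pnat_card_pchar : ([pchar Fq].-nat #|Fr|)%N.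
Proof.
have [p _ pFr] := finPcharP Fr.
have pFq : p \in [pchar Fq] by rewrite (fmorph_pchar iota).
by rewrite (eq_pnat _ (pcharf_eq pFq)) pnat_card_finField.
Qed.

(** With r = p^k and q = p^l, the number p^l - 1 is congruent to p^(l mod k) - 1 modulo r - 1. As r
    - 1 divides q - 1 and p^(l mod k) < r, this residue is 0, so k divides l. *)
Lemma card_finField_expn : exists2 n, (0 < n)%N & #|Fq| = (#|Fr| ^ n)%N.
Proof.
have [p p_pr pFr] := finPcharP Fr.
have pFq : p \in [pchar Fq] by rewrite (fmorph_pchar iota).
have /p_natP[k rE] := pnat_card_finField pFr.
have /p_natP[l qE] := pnat_card_finField pFq.
have p_gt1 := prime_gt1 p_pr.
have r_gt1 := finNzRing_gt1 Fr; have q_gt1 := finNzRing_gt1 Fq.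
have k_gt0 : (0 < k)%N by rewrite -(ltn_exp2l _ _ p_gt1) expn0 -rE.
have l_gt0 : (0 < l)%N by rewrite -(ltn_exp2l _ _ p_gt1) expn0 -qE.
suff k_l : (k %| l)%N.
  exists (l %/ k)%N; first by rewrite divn_gt0 // dvdn_leq.
  by rewrite rE qE -expnM mulnC divnK.
have := card_predn_dvd; rewrite [in X in (_ %| X)%N]qE (divn_eq l k).
have -> : (p ^ (l %/ k * k + l %% k)).-1
        = ((p ^ (l %% k)) * (#|Fr| ^ (l %/ k)).-1 + (p ^ (l %% k)).-1)%N.
  rewrite rE -expnM [(k * _)%N]mulnC expnD.
  have : (0 < p ^ (l %/ k * k))%N by rewrite expn_gt0 ltnW.
  have : (0 < p ^ (l %% k))%N by rewrite expn_gt0 ltnW.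
  by case: (p ^ _)%N => // s _; case: (p ^ _)%N => // t _ /=; lia.
rewrite predn_exp mulnCA dvdn_addr ?dvdn_mulr //.
have : (0 < p ^ (l %% k))%N by rewrite expn_gt0 ltnW.
have : (p ^ (l %% k) < #|Fr|)%N by rewrite rE ltn_exp2l // ltn_pmod.
move=> lt1 lt2 /dvdn_leq le1; rewrite /dvdn.
have /eqP : (p ^ (l %% k) == 1)%N.
  case: (p ^ (l %% k))%N lt1 lt2 le1 => [//|[//|s]] /=.
  by move=> lt1 _ /(_ isT); case: #|Fr| lt1 r_gt1 => [//|u] /=; lia.
rewrite addnC; case: (l %% k)%N => [|s]; first by rewrite modnMl.
by move/eqP; rewrite -(expn0 p) eqn_exp2l.
Qed.

(** Over [Fr] the polynomial X^r - X is the product of all X - c; the image of this factorization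
    under [iota] accounts for every root in [Fq]. *)
Lemma expf_card_image (x : Fq) : x ^+ #|Fr| = x -> exists c, x = iota c.
Proof.
move=> xr; have := congr1 (map_poly iota) (finField_genPoly Fr).
rewrite rmorphB /= map_polyXn map_polyX rmorph_prod /= => /(congr1 (horner^~ x)).
rewrite !hornerE xr subrr horner_prod => /esym/eqP/prodf_eq0[c _].
by rewrite map_polyXsubC !hornerE subr_eq0 => /eqP->; exists c.
Qed.

Lemma pnat_card_poly : ([pchar {poly Fq}].-nat #|Fr|)%N.
Proof. by rewrite (eq_pnat _ (pchar_poly _)) pnat_card_pchar. Qed.

End FieldExtensionCard.

(** * Additivity of Frobenius powers *)

Lemma exprBn_pchar (R : comNzRingType) (x y : R) n :
  ([pchar R].-nat n)%N -> (x - y) ^+ n = x ^+ n - y ^+ n.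
Proof. by move=> pn; apply/(addIr (y ^+ n)); rewrite -exprDn_pchar // !subrK. Qed.

Lemma expr_sum_pchar (R : comNzRingType) I (s : seq I) (P : pred I) (F : I -> R) n :
  ([pchar R].-nat n)%N ->
  (\sum_(i <- s | P i) F i) ^+ n = \sum_(i <- s | P i) F i ^+ n.
Proof.
move=> pn; apply: (big_morph (fun x => x ^+ n)) => [x y|].
  exact: exprDn_pchar.
by rewrite expr0n; case: n pn.
Qed.

Lemma dvdp_exprB_pchar (F : fieldType) (f P Q : {poly F}) n :
  ([pchar {poly F}].-nat n)%N -> f %| P - Q -> f %| P ^+ n - Q ^+ n.
Proof.
move=> pn fPQ; rewrite -exprBn_pchar //; apply: (dvdp_trans fPQ).
by case: n pn => // n _; rewrite exprS dvdp_mulIl.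
Qed.

(** * Central polynomials *)

Section CentralPolynomials.
Variables (Fr Fq : finFieldType) (iota : {rmorphism Fr -> Fq}).
Notation r := #|Fr|.
Notation q := #|Fq|.
Implicit Types (s t : {poly Fr}) (P : {poly Fq}).

Let q_gt1 : (1 < q)%N := finNzRing_gt1 Fq.
Let q_gt0 : (0 < q)%N := ltnW q_gt1.

Lemma pnat_card_poly_id : ([pchar {poly Fq}].-nat q)%N.
Proof. exact: (pnat_card_poly idfun). Qed.

Lemma expf_iota c : iota c ^+ q = iota c. Proof. exact: expf_card. Qed.

(** The inverse of [tau] on F_r[x;q]. Since it turns products into compositions ([cenM]), central
    polynomials can be handled as elements of F_r[y]. *)
Definition cen s : {poly Fq} := \sum_(i < size s) iota s`_i *: 'X^(q ^ i).

Lemma cen_widen n s :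
  (size s <= n)%N -> cen s = \sum_(i < n) iota s`_i *: 'X^(q ^ i).
Proof.
move=> le_sn; rewrite /cen (big_ord_widen n (fun i => iota s`_i *: 'X^(q ^ i))) //.
rewrite big_mkcond; apply: eq_bigr => i _; case: ltnP => // le_si.
by rewrite nth_default // rmorph0 scale0r.
Qed.

Lemma cenD s t : cen (s + t) = cen s + cen t.
Proof.
set n := maxn (size s) (size t).
rewrite (@cen_widen n s) ?leq_maxl // (@cen_widen n t) ?leq_maxr //.
rewrite (@cen_widen n) ?size_polyD // -big_split; apply: eq_bigr => i _ /=.
by rewrite coefD rmorphD scalerDl.
Qed.

Lemma cenZ c s : cen (c *: s) = iota c *: cen s.
Proof.
rewrite (@cen_widen (size s)) ?size_scale_leq // scaler_sumr.
by apply: eq_bigr => i _; rewrite coefZ rmorphM scalerA.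
Qed.

Lemma cen0 : cen 0 = 0.
Proof. by rewrite /cen size_poly0 big_ord0. Qed.

Lemma cenN s : cen (- s) = - cen s.
Proof. by rewrite -scaleN1r cenZ rmorphN1 scaleN1r. Qed.

Lemma cenB s t : cen (s - t) = cen s - cen t.
Proof. by rewrite cenD cenN. Qed.

Lemma cenC c : cen c%:P = iota c *: 'X.
Proof.
by rewrite (@cen_widen 1) ?size_polyC_leq1 // big_ord1 coefC expn0 expr1.
Qed.

(** The q-th power map is additive and fixes the coefficients, so it only shifts the exponents
    q^i. *)
Lemma cenXM s : cen ('X * s) = cen s ^+ q.
Proof.
rewrite (@cen_widen (size s).+1); last first.
  by rewrite mulrC (leq_trans (size_polyMleq _ _)) // size_polyX addn2.
rewrite big_ord_recl coefXM eqxx rmorph0 scale0r add0r.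
rewrite /cen (expr_sum_pchar _ _ _ pnat_card_poly_id); apply: eq_bigr => i _.
by rewrite coefXM /= exprZn expf_iota -exprM expnSr.
Qed.

Lemma cen_comp s P : cen s \Po P = \sum_(i < size s) iota s`_i *: P ^+ (q ^ i).
Proof.
rewrite rmorph_sum; apply: eq_bigr => i _ /=.
by rewrite comp_polyZ comp_Xn_poly.
Qed.

Lemma cen_compXq s P : cen s \Po P ^+ q = (cen s \Po P) ^+ q.
Proof.
rewrite !cen_comp (expr_sum_pchar _ _ _ pnat_card_poly_id); apply: eq_bigr => i _.
by rewrite exprZn expf_iota -!exprM mulnC.
Qed.

(** Horner induction on [s]: multiplication by the variable is the q-th power map, which commutes
    with [cen s] by [cen_compXq]. *)
Lemma cenM s t : cen (s * t) = cen s \Po cen t.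
Proof.
elim/poly_ind: s t => [|s c IHs] t; first by rewrite mul0r cen0 comp_poly0.
rewrite mulrDl cenD -mulrA IHs cenXM mul_polyC cenZ cenD cenC comp_polyD.
congr (_ + _); last by rewrite comp_polyZ comp_polyX.
by rewrite [s * _]mulrC !cenXM rmorphXn /= cen_compXq.
Qed.

Lemma coef_cen s i : (cen s)`_(q ^ i) = iota s`_i.
Proof.
rewrite (cen_widen (leq_maxl (size s) i.+1)) coef_sum.
have lt_i : (i < maxn (size s) i.+1)%N by rewrite leq_maxr.
rewrite (bigD1 (Ordinal lt_i)) //= coefZ coefXn eqxx mulr1 big1 ?addr0 // => j.
by rewrite -val_eqE /= coefZ coefXn eqn_exp2l // eq_sym => /negPf->; rewrite mulr0.
Qed.

Lemma size_cen s : s != 0 -> size (cen s) = (q ^ (size s).-1).+1.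
Proof.
move=> nz_s; apply/eqP; rewrite eqn_leq; apply/andP; split.
  rewrite (leq_trans (size_sum _ _ _)) //; apply/bigmax_leqP=> i _.
  rewrite (leq_trans (size_scale_leq _ _)) // size_polyXn ltnS leq_exp2l //.
  by rewrite -ltnS prednK ?lt0n ?size_poly_eq0.
rewrite ltnNge; apply/negP=> /leq_sizeP/(_ _ (leqnn _))/eqP.
by rewrite coef_cen fmorph_eq0 -lead_coefE lead_coef_eq0 (negPf nz_s).
Qed.

Lemma lead_coef_cen s : lead_coef (cen s) = iota (lead_coef s).
Proof.
have [->|nz_s] := eqVneq s 0; first by rewrite cen0 !lead_coef0 rmorph0.
by rewrite lead_coefE size_cen // coef_cen -lead_coefE.
Qed.

Lemma cen_monic s : (cen s \is monic) = (s \is monic).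
Proof. by rewrite !monicE lead_coef_cen fmorph_eq1. Qed.

Lemma tau_cen s : tau iota q (cen s) = s.
Proof. by rewrite (@tauE _ _ iota q (size s) (fun i => s`_i)) // coefK. Qed.

Lemma cen_inj : injective cen.
Proof. exact: can_inj tau_cen. Qed.

Lemma central_polyP P : central_poly iota q P <-> exists s, P = cen s.
Proof.
split=> [[n [a ->]]|[s ->]].
  exists (\poly_(i < n.+1) a i); rewrite (@cen_widen n.+1) ?size_poly //.
  by apply: eq_bigr => i _; rewrite coef_poly ltn_ord.
by exists (size s), (fun i => s`_i); rewrite -cen_widen.
Qed.

Lemma cenX : cen 'X = 'X^q.
Proof. by rewrite -(mulr1 'X) cenXM -polyC1 cenC rmorph1 scale1r. Qed.

Lemma cenXsubC c : cen ('X - c%:P) = 'X^q - iota c *: 'X.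
Proof. by rewrite cenB cenC cenX. Qed.

End CentralPolynomials.

(** * Linear right factors and norms *)

Section AdditiveTrinomials.
Variables (Fr Fq : finFieldType) (iota : {rmorphism Fr -> Fq}).
Notation r := #|Fr|.
Notation q := #|Fq|.
Notation cen := (cen iota).
Notation "s ^iota" := (map_poly iota s) (at level 2, format "s ^iota").
Implicit Types (s t : {poly Fr}) (P : {poly Fq}) (a b v : Fq).

Let q_gt1 : (1 < q)%N := finNzRing_gt1 Fq.
Let r_gt1 : (1 < r)%N := finNzRing_gt1 Fr.
Let q_gt0 : (0 < q)%N := ltnW q_gt1.
Let r_gt0 : (0 < r)%N := ltnW r_gt1.
Let pnat_r := pnat_card_poly iota.
Let pnat_q := pnat_card_poly_id Fq.
Let pnat_rX k : ([pchar {poly Fq}].-nat (r ^ k))%N.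
Proof. by rewrite pnatX pnat_r. Qed.

(** The general monic element of F_q[x;r] of degree r; see [additive_degree_r]. *)
Definition rlin v : {poly Fq} := 'X^r - v *: 'X.

Lemma size_rlin v : size (rlin v) = r.+1.
Proof.
rewrite size_polyDl size_polyXn // size_polyN.
by rewrite (leq_ltn_trans (size_scale_leq _ _)) // size_polyX ltnS.
Qed.

Lemma rlin_monic v : rlin v \is monic.
Proof.
rewrite monicE lead_coefDl ?lead_coefXn // size_polyN size_polyXn.
by rewrite (leq_ltn_trans (size_scale_leq _ _)) // size_polyX ltnS.
Qed.

Lemma dvdp_rlinZX v c : (rlin v %| c *: 'X) = (c == 0).
Proof.
have [->|nz_c] := eqVneq c 0; first by rewrite scale0r dvdp0.
apply/negP=> /dvdp_leq; rewrite scaler_eq0 (negPf nz_c) polyX_eq0 => /(_ isT).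
by rewrite size_rlin size_scale // size_polyX leqNgt ltnS r_gt1.
Qed.

(* (q - 1) / (r - 1) = 1 + r + ... + r^(n-1) for q = r^n: the norm from F_q to F_r. *)
Definition fqnorm v : Fq := v ^+ (q.-1 %/ r.-1).

Lemma predn_divn n : q = (r ^ n)%N -> (q.-1 %/ r.-1)%N = (\sum_(i < n) r ^ i)%N.
Proof. by move->; rewrite predn_exp mulKn // -ltnS prednK. Qed.

(** The r-th power of X^(r^k) = cX modulo [rlin v] is c^r X^r = c^r v X, so the exponents of v
    satisfy e_(k+1) = r e_k + 1. *)
Lemma dvdp_rlin_Xexp v k :
  rlin v %| 'X^(r ^ k) - v ^+ (\sum_(i < k) r ^ i)%N *: 'X.
Proof.
elim: k => [|k IHk]; first by rewrite big_ord0 scale1r subrr dvdp0.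
have /(dvdp_exprB_pchar pnat_r) := IHk.
rewrite -exprM -expnSr exprZn -exprM.
have -> : (\sum_(i < k.+1) r ^ i = (\sum_(i < k) r ^ i) * r + 1)%N.
  rewrite big_ord_recl addnC big_distrl /=; congr (_ + _)%N.
  by apply: eq_bigr => i _; rewrite expnSr.
rewrite exprD expr1; set c := v ^+ _ => dv.
have -> : 'X^(r ^ k.+1) - (c * v) *: 'X = ('X^(r ^ k.+1) - c *: 'X^r) + c%:P * rlin v.
  by rewrite /rlin -!mul_polyC; ring.
by rewrite dvdp_add // dvdp_mull.
Qed.

Lemma dvdp_rlin_Xq v : rlin v %| 'X^q - fqnorm v *: 'X.
Proof.
have [n _ qE] := card_finField_expn iota.
by rewrite /fqnorm (predn_divn qE) {1}qE dvdp_rlin_Xexp.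
Qed.

(** Horner induction: modulo [rlin v], the q-th power of dX is d X^q = d N(v) X, so [cen s] acts on
    X as evaluation of [s] at the norm. *)
Lemma dvdp_rlin_cenB v s : rlin v %| cen s - s^iota.[fqnorm v] *: 'X.
Proof.
elim/poly_ind: s => [|s c IHs].
  by rewrite cen0 map_poly0 horner0 scale0r subrr dvdp0.
rewrite cenD mulrC cenXM cenC rmorphD rmorphM /= map_polyX map_polyC !hornerE /=.
have /(dvdp_exprB_pchar pnat_q) := IHs; rewrite exprZn expf_card.
set d := _.[_] => dv; set N := fqnorm v.
have -> : cen s ^+ q + iota c *: 'X - (N * d + iota c) *: 'X =
     (cen s ^+ q - d *: 'X^q) + d%:P * ('X^q - N *: 'X).
  by rewrite -!mul_polyC; ring.
by rewrite dvdp_add // dvdp_mull // dvdp_rlin_Xq.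
Qed.

Lemma dvdp_rlin_cen v s : (rlin v %| cen s) = root s^iota (fqnorm v).
Proof.
rewrite -(subrK (s^iota.[fqnorm v] *: 'X) (cen s)) dvdp_addr ?dvdp_rlin_cenB //.
by rewrite dvdp_rlinZX.
Qed.

(** For v nonzero, N(v)^(r-1) = v^(q-1) = 1, so N(v) is fixed by the r-th power map. *)
Lemma fqnorm_iota v : exists c, fqnorm v = iota c.
Proof.
apply: expf_card_image; rewrite /fqnorm -exprM mulnC exprM.
have /divnK e := card_predn_dvd iota.
have [->|nz_v] := eqVneq v 0; first by rewrite expr0n (gtn_eqF r_gt0).
rewrite -(prednK r_gt0) exprS exprMn -!exprM mulnC -/(_ %/ _)%N.
by rewrite e expf_card1 // mulr1.
Qed.

Let predn_r_gt0 : (0 < r.-1)%N. Proof. by case: #|Fr| r_gt1 => [|[]]. Qed.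

Let norm_exp_gt0 : (0 < q.-1 %/ r.-1)%N.
Proof.
rewrite divn_gt0 // dvdn_leq ?(card_predn_dvd iota) //.
by case: #|Fq| q_gt1 => [|[]].
Qed.

(** * Fibres of the norm *)

Lemma fqnorm0 : fqnorm 0 = 0.
Proof. by rewrite /fqnorm expr0n (gtn_eqF norm_exp_gt0). Qed.

Lemma fqnorm_eq0 v : (fqnorm v == 0) = (v == 0).
Proof. by rewrite /fqnorm expf_eq0 norm_exp_gt0. Qed.

Definition fiber (c : Fr) : {set Fq} := [set v | fqnorm v == iota c]%SET.

Lemma card_fiber0 : #|fiber 0| = 1%N.
Proof.
apply/eqP/cards1P; exists 0; apply/setP=> v.
by rewrite !inE rmorph0 fqnorm_eq0.
Qed.

Let size_normpoly (c : Fq) : size ('X^(q.-1 %/ r.-1) - c%:P) = (q.-1 %/ r.-1).+1.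
Proof. by rewrite size_XnsubC. Qed.

Lemma card_fiber_le c : (#|fiber c| <= q.-1 %/ r.-1)%N.
Proof.
rewrite cardE -ltnS -(size_normpoly (iota c)).
apply: max_poly_roots; rewrite ?enum_uniq -?size_poly_eq0 ?size_normpoly //.
by apply/allP=> v; rewrite mem_enum inE rootE !hornerE subr_eq0.
Qed.

Lemma sum_card_fiber : (\sum_c #|fiber c| = q)%N.
Proof.
rewrite -sum1_card (partition_big (fun v => iota_inv iota (fqnorm v)) predT) //=.
apply: eq_bigr => c _; rewrite -sum1_card; apply: eq_bigl => v.
rewrite inE; have [d ->] := fqnorm_iota v; rewrite (inj_eq (fmorph_inj iota)) /iota_inv.
case: pickP => [e /eqP /fmorph_inj -> //|/(_ d)]; by rewrite eqxx.
Qed.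

(** Each of the r - 1 fibres over nonzero elements has at most (q-1)/(r-1) elements, and together
    they contain q - 1, so every bound is attained. *)
Lemma card_fiber (c : Fr) : c != 0 -> #|fiber c| = (q.-1 %/ r.-1)%N.
Proof.
set M := (q.-1 %/ r.-1)%N => nz_c.
have : (\sum_(d : Fr | d != 0%R) #|fiber d| = \sum_(d : Fr | d != 0%R) M)%N.
  rewrite sum_nat_const cardC1 mulnC divnK ?(card_predn_dvd iota) //.
  by have := sum_card_fiber; rewrite (bigD1 0) //= card_fiber0 add1n => <-.
have le_fib (d : Fr) : (#|fiber d| <= M)%N by apply: card_fiber_le.
rewrite !(bigD1 c nz_c) /= => e; apply/eqP; rewrite eqn_leq le_fib /=.
have : (\sum_(d : Fr | (d != 0%R) && (d != c)) #|fiber d|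
        <= \sum_(d : Fr | (d != 0%R) && (d != c)) M)%N by apply: leq_sum.
by rewrite -(leq_add2l M) -e leq_add2r.
Qed.

Lemma XnsubC_fiber (c : Fr) : c != 0 ->
  'X^(q.-1 %/ r.-1) - (iota c)%:P = \prod_(v <- enum (fiber c)) ('X - v%:P).
Proof.
move=> nz_c; rewrite (@all_roots_prod_XsubC _ ('X^(q.-1 %/ r.-1) - (iota c)%:P)
                        (enum (fiber c))).
- by rewrite (monicP (monicXnsubC _ _)) ?scale1r.
- by rewrite size_normpoly -cardE card_fiber.
- by apply/allP=> v; rewrite mem_enum inE rootE !hornerE subr_eq0.
- by rewrite uniq_rootsE enum_uniq.
Qed.

(** * Closure properties of additive polynomials *)

Lemma additive_monomial (c : Fq) k : additive_poly r (c *: 'X^(r ^ k)).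
Proof.
exists k, (fun i => if i == k then c else 0).
rewrite (bigD1 (@Ordinal k.+1 k (leqnn _))) //= eqxx big1 ?addr0 // => i.
by rewrite -val_eqE /= => /negPf->; rewrite scale0r.
Qed.

Lemma additiveD P Q :
  additive_poly r P -> additive_poly r Q -> additive_poly r (P + Q).
Proof.
move=> [n [c ->]] [k [d ->]].
pose ext n0 (c0 : nat -> Fq) i := if (i <= n0)%N then c0 i else 0.
have extE n0 (c0 : nat -> Fq) n1 : (n0 <= n1)%N ->
    \sum_(i < n0.+1) c0 i *: 'X^(r ^ i)
      = \sum_(i < n1.+1) ext n0 c0 i *: 'X^(r ^ i) :> {poly Fq}.
  move=> le01; rewrite (big_ord_widen n1.+1 (fun i => c0 i *: 'X^(r ^ i))) //.
  rewrite big_mkcond; apply: eq_bigr => i _; rewrite /ext ltnS.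
  by case: ifP; rewrite ?scale0r.
exists (maxn n k), (fun i => ext n c i + ext k d i).
rewrite (extE n c _ (leq_maxl n k)) (extE k d _ (leq_maxr n k)) -big_split.
by apply: eq_bigr => i _; rewrite scalerDl.
Qed.

Lemma additiveZ (c : Fq) P : additive_poly r P -> additive_poly r (c *: P).
Proof.
move=> [n [d ->]]; exists n, (fun i => c * d i); rewrite scaler_sumr.
by apply: eq_bigr => i _; rewrite scalerA.
Qed.

(** As q is a power of r, each X^(q^i) is an r-additive monomial. *)
Lemma additive_cen s : additive_poly r (cen s).
Proof.
have [n _ qE] := card_finField_expn iota.
rewrite -[cen s]comp_polyXr cen_comp; elim/big_ind: _ => [||i _].
- by have := additive_monomial 0 0; rewrite scale0r.
- exact: additiveD.
- by rewrite qE -expnM; apply: additive_monomial.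
Qed.

(** * The minimal central left composition *)

Section FixedCoefficients.
Variables a b : Fq.
Notation f := (fab r a b).

(* f = X * projp(X^(r-1)). *)
Definition projp : {poly Fq} := 'X^(r.+1) + a *: 'X + b%:P.

Let r_lt_r2 : (r < r ^ 2)%N.
Proof. by rewrite -{1}(expn1 r) ltn_exp2l. Qed.

Lemma size_low c d : (size (c *: 'X^r + d *: 'X : {poly Fq})%R <= r.+1)%N.
Proof.
rewrite (leq_trans (size_polyD _ _)) // geq_max !(leq_trans (size_scale_leq _ _)) //.
  by rewrite size_polyX ltnS.
by rewrite size_polyXn.
Qed.

Lemma size_fab : size f = (r ^ 2).+1.
Proof.
by rewrite /fab -addrA size_polyDl size_polyXn // (leq_ltn_trans (size_low _ _)).
Qed.

Lemma fab_monic : f \is monic.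
Proof.
rewrite monicE /fab -addrA lead_coefDl ?lead_coefXn //.
by rewrite size_polyXn // (leq_ltn_trans (size_low _ _)).
Qed.

Lemma size_projp : size projp = r.+2.
Proof.
rewrite /projp -addrA size_polyDl size_polyXn // (leq_ltn_trans (size_polyD _ _)) //.
rewrite gtn_max (leq_ltn_trans (size_scale_leq _ _)) ?size_polyX //.
by rewrite (leq_ltn_trans (size_polyC_leq1 _)).
Qed.

Lemma projpE v : projp.[v] = v ^+ r.+1 + a * v + b.
Proof. by rewrite !hornerE. Qed.

(** The degree is below r^2. Hence X^r and X are independent modulo [f], and they serve below as a
    basis of the remainders. *)
Lemma dvdp_fab_low c d : (f %| c *: 'X^r + d *: 'X) = (c == 0) && (d == 0).
Proof.
apply/idP/andP=> [|[/eqP-> /eqP->]]; last by rewrite !scale0r addr0 dvdp0.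
move=> dv; have /eqP p0 : c *: 'X^r + d *: 'X == 0 :> {poly Fq}.
  apply: contraTT dv => nz_p; apply/negP=> /(dvdp_leq nz_p).
  by rewrite size_fab leqNgt (leq_ltn_trans (size_low _ _)).
have := congr1 (fun P : {poly Fq} => (P`_r, P`_1)) p0.
rewrite !coefD !coefZ !coefXn !coefX !coef0 !eqxx [(1 == r)%N]eq_sym (gtn_eqF r_gt1) /=.
by rewrite !mulr0 !mulr1 addr0 add0r => -[-> ->].
Qed.

(** Modulo [rlin v], [f] reduces to (v^(r+1) + av + b)X. *)
Lemma dvdp_rlin_fab v : (rlin v %| f) = root projp v.
Proof.
rewrite rootE projpE -(dvdp_rlinZX v); set c := (X in X *: 'X).
rewrite -(subrK (c *: 'X) f) dvdp_addr //.
have := dvdp_rlin_Xexp v 2; rewrite big_ord_recl big_ord1 expn0 expn1 add1n => dv.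
have -> : f - c *: 'X = ('X^(r ^ 2) - v ^+ r.+1 *: 'X) + a%:P * rlin v.
  by rewrite /f /fab /rlin /c -!mul_polyC; ring.
by rewrite dvdp_add // dvdp_mull.
Qed.

Lemma dvdp_fab_lowmod P c d :
  f %| P - (c *: 'X^r + d *: 'X) -> (f %| P) = (c == 0) && (d == 0).
Proof.
move=> dP; rewrite -(subrK (c *: 'X^r + d *: 'X) P) dvdp_addr //.
exact: dvdp_fab_low.
Qed.

(** Right Euclidean division by [f] in F_q[x;r]; an additive remainder of degree below r^2 involves
    only X^r and X. *)
Definition has_right_division P : Prop := exists g c d,
  additive_poly r g /\ P = (g \Po f) + (c *: 'X^r + d *: 'X).

Lemma additive_right_division P : additive_poly r P -> has_right_division P.
Proof.
have redD P1 P2 : has_right_division P1 -> has_right_division P2 ->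
    has_right_division (P1 + P2).
  move=> [g1 [c1 [d1 [ag1 ->]]]] [g2 [c2 [d2 [ag2 ->]]]].
  exists (g1 + g2), (c1 + c2), (d1 + d2); split; first exact: additiveD.
  by rewrite comp_polyD !scalerDl addrACA; congr (_ + _); rewrite addrACA.
have redZ c P1 : has_right_division P1 -> has_right_division (c *: P1).
  move=> [g1 [c1 [d1 [ag1 ->]]]]; exists (c *: g1), (c * c1), (c * d1).
  by split; [exact: additiveZ | rewrite comp_polyZ !scalerDr !scalerA].
have red_low c d : has_right_division (c *: 'X^r + d *: 'X).
  exists 0, c, d; rewrite comp_poly0 add0r; split=> //.
  by have := additive_monomial 0 0; rewrite scale0r.
(* Two consecutive exponents are carried, since composing X^(r^k) with [f] expresses X^(r^(k+2))
   through the two preceding monomials. *)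
have redX k : has_right_division 'X^(r ^ k) /\ has_right_division 'X^(r ^ k.+1).
  elim: k => [|k [IH0 IH1]].
    rewrite expn0 expn1; split; last first.
      by have := red_low 1 0; rewrite scale1r scale0r addr0.
    by have := red_low 0 1; rewrite scale1r scale0r add0r.
  split=> //.
  have -> : 'X^(r ^ k.+2) = ('X^(r ^ k) \Po f) + (- a ^+ (r ^ k)) *: 'X^(r ^ k.+1)
               + (- b ^+ (r ^ k)) *: 'X^(r ^ k).
    rewrite comp_Xn_poly /fab !exprDn_pchar // !exprZn -!exprM -expnS -expnD add2n.
    by rewrite !scaleNr; ring.
  apply: (redD _ _ _ (redZ _ _ IH0)); apply: (redD _ _ _ (redZ _ _ IH1)).
  exists 'X^(r ^ k), 0, 0; rewrite !scale0r !addr0; split=> //.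
  by have := additive_monomial 1 k; rewrite scale1r.
move=> [n [c ->]]; elim/big_ind: _ => [||i _].
- by have := red_low 0 0; rewrite !scale0r addr0.
- exact: redD.
- by apply: redZ; case: (redX i).
Qed.

Lemma dvdp_comp_additive g : additive_poly r g -> f %| g \Po f.
Proof.
move=> [n [c ->]]; rewrite rmorph_sum; elim/big_ind: _ => [||i _] /=.
- exact: dvdp0.
- by move=> *; apply: dvdp_add.
rewrite comp_polyZ comp_Xn_poly -mul_polyC dvdp_mull //.
by rewrite -(prednK (_ : 0 < r ^ i)%N) ?expn_gt0 ?r_gt0 // exprS dvdp_mulIl.
Qed.

(** Replaces left composition by ordinary divisibility: g(f) is a multiple of [f], and a remainder
    divisible by [f] is zero. *)
Lemma left_compositionP P : additive_poly r P ->
  (exists g, additive_poly r g /\ P = g \Po f) <-> f %| P.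
Proof.
move=> /additive_right_division[g [c [d [ag PE]]]]; split=> [[g1 [ag1 ->]]|].
  exact: dvdp_comp_additive.
rewrite {1}PE dvdp_addr ?dvdp_comp_additive // dvdp_fab_low => /andP[/eqP c0 /eqP d0].
by exists g; split=> //; rewrite PE c0 d0 !scale0r !addr0.
Qed.

Lemma additive_lowmod P : additive_poly r P ->
  exists c d, f %| P - (c *: 'X^r + d *: 'X).
Proof.
move=> /additive_right_division[g [c [d [ag ->]]]]; exists c, d.
by rewrite addrK dvdp_comp_additive.
Qed.

Lemma is_central_left_compositionP P :
  is_central_left_composition iota r q f P <->
  exists s, [/\ P = cen s, s \is monic & f %| cen s].
Proof.
split=> [[/central_polyP[s ->]]|[s [-> mon_s fs]]].
  rewrite cen_monic => mon_s /(left_compositionP (additive_cen s)) fs.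
  by exists s.
split; first by apply/central_polyP; exists s.
  by rewrite cen_monic.
exact/(left_compositionP (additive_cen s)).
Qed.

(** With this, the polynomials [s] such that [f] divides [cen s] form an ideal of F_r[y]. *)
Lemma dvdp_fab_cenM s t : f %| cen t -> f %| cen (s * t).
Proof.
move=> ft0; rewrite cenM cen_comp; elim/big_ind: _ => [||i _].
- exact: dvdp0.
- by move=> *; apply: dvdp_add.
rewrite -mul_polyC dvdp_mull //.
by rewrite -(prednK (_ : 0 < q ^ i)%N) ?expn_gt0 ?q_gt0 // exprS dvdp_mulr.
Qed.

Lemma min_centralP : (exists s, s \is monic /\ f %| cen s) ->
  exists m, [/\ m \is monic, min_central iota r q f = cen m &
    forall s, (f %| cen s) = (m %| s)].
Proof.
move=> [s0 [mon_s0 fs0]].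
pose Q k := `[< exists s, [/\ s \is monic, f %| cen s & size s = k] >].
have exQ : exists k, Q k by exists (size s0); apply/asboolP; exists s0.
case: (ex_minnP exQ) => k /asboolP[m [mon_m fm sz_m]] min_k.
have fE s : (f %| cen s) = (m %| s).
  apply/idP/idP=> [fs|/dvdpP[u ->]]; last exact: dvdp_fab_cenM.
  have : f %| cen (s %% m).
    have /eqP := divp_eq s m; rewrite eq_sym addrC eq_sym -subr_eq => /eqP <-.
    by rewrite cenB dvdp_sub // dvdp_fab_cenM.
  (* A nonzero remainder, made monic, would contradict the minimality of the size of [m]. *)
  rewrite /dvdp; set t := s %% m => f_t; apply: contraT => nz_t.
  have nz_lt : lead_coef t != 0 by rewrite lead_coef_eq0.
  have /min_k : Q (size t).
    apply/asboolP; exists ((lead_coef t)^-1 *: t).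
    rewrite monicE lead_coefZ mulVf // cenZ size_scale ?invr_eq0 //; split=> //.
    by rewrite -mul_polyC dvdp_mull.
  by rewrite -sz_m leqNgt ltn_modp monic_neq0.
have min_m : is_min_central_left_composition iota r q f (cen m).
  split; first by apply/is_central_left_compositionP; exists m.
  move=> G /is_central_left_compositionP[s [-> mon_s]]; rewrite fE => /dvdp_leq.
  rewrite monic_neq0 // => /(_ isT) le_ms.
  rewrite !size_cen ?monic_neq0 // ltnS leq_exp2l //.
  by rewrite -!subn1 leq_sub2r.
exists m; split=> //.
(* The chosen minimal composition is [cen s] with [m] dividing [s] and no larger size, so the two
   monic polynomials agree. *)
have := @xgetPex _ 0 (is_min_central_left_composition iota r q f) (ex_intro _ _ min_m).
rewrite -/(min_central iota r q f) => -[/is_central_left_compositionP[s [-> mon_s fs]]].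
move=> /(_ _ (proj1 min_m)) le_sm; congr (cen _); apply/eqP.
rewrite -eqp_monic // eqp_sym -dvdp_size_eqp -?fE // eqn_leq.
rewrite dvdp_leq ?monic_neq0 -?fE //=.
move: le_sm; rewrite !size_cen ?monic_neq0 // ltnS leq_exp2l //.
by rewrite -ltnS !prednK ?lt0n ?size_poly_eq0 ?monic_neq0.
Qed.

(** If [cen s] has remainder cX^r + dX modulo [f], then modulo [rlin v] it becomes (cv + d)X for
    each root v; vanishing at two distinct v forces c = d = 0. *)
Lemma dvdp_fab_two_roots v1 v2 s : root projp v1 -> root projp v2 -> v1 != v2 ->
  (f %| cen s) = root s^iota (fqnorm v1) && root s^iota (fqnorm v2).
Proof.
rewrite -!dvdp_rlin_fab => h1 h2 ne_v; rewrite -!dvdp_rlin_cen.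
apply/idP/andP=> [fs|[s1 s2]]; first by rewrite !(dvdp_trans _ fs).
have [c [d dv]] := additive_lowmod (additive_cen s).
have low v : rlin v %| f -> rlin v %| cen s -> c * v + d = 0.
  move=> hf hs; apply/eqP; rewrite -(dvdp_rlinZX v).
  have -> : (c * v + d) *: 'X
      = cen s - (cen s - (c *: 'X^r + d *: 'X)) - c%:P * rlin v.
    by rewrite /rlin -!mul_polyC; ring.
  exact: dvdp_sub (dvdp_sub hs (dvdp_trans hf dv)) (dvdp_mulIr _ _).
have e1 := low _ h1 s1; have e2 := low _ h2 s2.
have : c * (v1 - v2) = 0 by rewrite -(subrr 0) -{1}e1 -e2; ring.
move/eqP; rewrite mulf_eq0 subr_eq0 (negPf ne_v) orbF => /eqP c0.
by rewrite (dvdp_fab_lowmod dv) c0 eqxx -e1 c0 mul0r add0r eqxx.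
Qed.

(* With T = X^r and X^q = A T + B X modulo f, the q-th power map acts linearly on
   the remainders spanned by T and X; t and d are its trace and determinant.  It commutes
   with the r-th power map, which puts t and d in F_r when b <> 0. *)
Lemma exists_charpoly : b != 0 ->
  exists t d : Fr, f %| cen ('X^2 - t%:P * 'X + d%:P).
Proof.
move=> nz_b; set x : {poly Fq} := 'X; set T : {poly Fq} := 'X^r.
have [A [B H1]] : exists A B, f %| 'X^q - (A *: T + B *: x).
  have [A [B H1]] := additive_lowmod (additive_cen 'X).
  by exists A, B; rewrite -(cenX iota).
have fE : f = T ^+ r + a *: T + b *: x by rewrite /fab /T -exprM.
(* The coordinates of T^q, obtained from the r-th power of [H1] and the relation T^r = -aT - bX
   modulo [f]. *)
pose e : Fq := B ^+ r - a * A ^+ r; pose g : Fq := - b * A ^+ r.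
have H3 : f %| T ^+ q - (e *: T + g *: x).
  have := dvdp_exprB_pchar pnat_r H1.
  rewrite exprDn_pchar // !exprZn exprAC -/T => H2.
  have -> : T ^+ q - (e *: T + g *: x)
    = (T ^+ q - (A ^+ r *: T ^+ r + B ^+ r *: T)) + (A ^+ r)%:P * f.
    by rewrite fE /e /g -!mul_polyC !(polyCN, polyCD, polyCM); ring.
  by rewrite dvdp_add // dvdp_mull.
(* This expands f^q, which vanishes modulo [f], in the basis T, X. Both coordinates are therefore
   zero. *)
have low0 : f %| (- a * e ^+ r + g ^+ r + a * e + b * A) *: T
               + (- b * e ^+ r + a * g + b * B) *: x.
  have := dvdp_exprB_pchar pnat_r H3.
  rewrite exprDn_pchar // !exprZn exprAC -/T => H4.
  have fq : f ^+ q = (T ^+ r) ^+ q + a *: T ^+ q + b *: 'X^q.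
    by rewrite fE !exprDn_pchar // !exprZn !expf_card.
  have dfq : f %| f ^+ q by rewrite -(prednK q_gt0) exprS dvdp_mulIl.
  set E := (X in f %| X).
  have -> : E = f ^+ q - ((T ^+ r) ^+ q - (e ^+ r *: T ^+ r + g ^+ r *: T))
      - a%:P * (T ^+ q - (e *: T + g *: x)) - b%:P * ('X^q - (A *: T + B *: x))
      - (e ^+ r)%:P * f.
    rewrite fq fE /E -!mul_polyC !(polyCN, polyCD, polyCM).
    by ring.
  apply: dvdp_sub; last exact: dvdp_mull.
  apply: dvdp_sub; last exact: dvdp_mull.
  apply: dvdp_sub; last exact: dvdp_mull.
  exact: dvdp_sub.
move: low0; rewrite dvdp_fab_low => /andP[/eqP eT /eqP ex].
(* Cancelling b in the X-coordinate; this is where b must be nonzero. *)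
have er : e ^+ r = B - a * A ^+ r.
  apply: (mulfI nz_b); apply/eqP; rewrite -subr_eq0 -oppr_eq0 -ex /g; apply/eqP.
  by ring.
have gr : g ^+ r = a * (B - B ^+ r) - b * A.
  rewrite -[LHS]subr0 -eT er /e; ring.
have frobD (u w : Fq) : (u + w) ^+ r = u ^+ r + w ^+ r.
  by rewrite exprDn_pchar // (pnat_card_pchar iota).
have frobN (u : Fq) : (- u) ^+ r = - u ^+ r.
  by apply/eqP; rewrite -addr_eq0 -frobD addNr expr0n (gtn_eqF r_gt0).
have [t tE] : exists t : Fr, B + e = iota t.
  by apply: expf_card_image; rewrite frobD er /e; ring.
have [d dE] : exists d : Fr, B * e - A * g = iota d.
  apply: expf_card_image.
  rewrite frobD frobN exprMn er [(A * g) ^+ r]exprMn gr /e /g; ring.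
exists t, d.
have -> : cen ('X^2 - t%:P * 'X + d%:P) = ('X^q) ^+ q - iota t *: 'X^q + iota d *: 'X.
  by rewrite cenD cenB cenC mul_polyC cenZ expr2 cenXM cenX.
have := dvdp_exprB_pchar pnat_q H1.
rewrite exprDn_pchar // !exprZn !expf_card => H5.
rewrite -tE -dE; set E := (X in f %| X).
(* The Cayley-Hamilton relation for the q-th power map, applied to X. *)
have -> : E = (('X^q) ^+ q - (A *: T ^+ q + B *: 'X^q))
    + A%:P * (T ^+ q - (e *: T + g *: x)) - e%:P * ('X^q - (A *: T + B *: x)).
  rewrite /E -!mul_polyC !(polyCN, polyCD, polyCM) -/x; ring.
apply: dvdp_sub; last exact: dvdp_mull.
by apply: dvdp_add; last exact: dvdp_mull.
Qed.

Lemma dvdp_fab_Xn N : f %| 'X^N -> a = 0 /\ b = 0.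
Proof.
rewrite -['X]subr0 -polyC0 => /dvdp_exp_XsubCP[k _].
rewrite polyC0 subr0 eqp_monic ?fab_monic ?monicXn // => /eqP fE.
have kE : k = (r ^ 2)%N by apply: succn_inj; rewrite -size_fab fE size_polyXn.
have : f %| a *: 'X^r + b *: 'X.
  have -> : a *: 'X^r + b *: 'X = f - 'X^(r ^ 2).
    by rewrite /fab; ring.
  by rewrite fE kE subrr dvdp0.
by rewrite dvdp_fab_low => /andP[/eqP-> /eqP->].
Qed.

(* The remainder of X^q - c' X modulo f is a multiple of X^r - wX: it generates a
   proper submodule of the remainders, as it is killed by X^q - c X, which does
   not kill X. *)
Lemma cen_quadratic_root c c' :
    f %| cen (('X - c%:P) * ('X - c'%:P)) ->
    ~~ (f %| cen ('X - c%:P)) -> ~~ (f %| cen ('X - c'%:P)) ->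
  exists w, root projp w /\ fqnorm w = iota c'.
Proof.
move=> fcc' nfc nfc'; set x : {poly Fq} := 'X; set T : {poly Fq} := 'X^r.
have [u [d dv]] := additive_lowmod (additive_cen ('X - c'%:P)).
set G := cen _ in nfc' dv; set p := u *: _ + _ in dv.
have fp : f %| p ^+ q - iota c *: p.
  have := dvdp_exprB_pchar pnat_q dv => dvq.
  have -> : p ^+ q - iota c *: p
      = cen (('X - c%:P) * ('X - c'%:P)) - (G ^+ q - p ^+ q) + (iota c)%:P * (G - p).
    by rewrite mulrBl cenB cenXM [c%:P * _]mul_polyC cenZ -/G -!mul_polyC; ring.
  by apply: dvdp_add; [exact: dvdp_sub | exact: dvdp_mull].
have nfx y : y != 0 -> ~~ (f %| y%:P * ('X^q - iota c *: x)).
  by move=> nz_y; rewrite mul_polyC dvdpZr // /x -cenXsubC.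
(* Otherwise [p] is dX with d nonzero, and [fp] would make [f] divide [cen ('X - c%:P)]. *)
have nz_u : u != 0.
  apply: contraNneq nfc' => u0; rewrite (dvdp_fab_lowmod dv) u0 eqxx /=.
  apply: contraLR fp => nz_d.
  have -> : p ^+ q - iota c *: p = d%:P * ('X^q - iota c *: x); last exact: nfx.
  rewrite /p u0 scale0r add0r exprZn expf_card -/x -!mul_polyC; ring.
have [w pE] : exists w, p = u%:P * rlin w.
  exists (- d / u).
  have -> : p = u *: T + (- (u * (- d / u))) *: x by rewrite mulrC divfK // opprK.
  by rewrite /rlin -/x -/T -!mul_polyC polyCN polyCM; ring.
exists w.
have fh : f %| rlin w ^+ q - iota c *: rlin w.
  rewrite -(dvdpZr _ _ nz_u).
  have <- // : p ^+ q - iota c *: p = u *: (rlin w ^+ q - iota c *: rlin w).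
  by rewrite pE mul_polyC exprZn expf_card -!mul_polyC; ring.
have fhr : f %| (rlin w ^+ q) ^+ r - iota c *: (rlin w) ^+ r.
  have := dvdp_exprB_pchar pnat_r fh.
  by rewrite exprZn -rmorphXn /= expf_card.
(* With h = [rlin w] and k = [projp.[w]], kX is a combination of [f], h^r and h. The map z -> z^q -
   cz sends all three to multiples of [f]; if k were nonzero, the same would hold for X, against
   [nfc]. *)
have root_w : root projp w.
  rewrite rootE; apply: contraT => /nfx; set k := projp.[w].
  have kx : k%:P * x = f - rlin w ^+ r - (a + w ^+ r)%:P * rlin w.
    rewrite /fab {1}/rlin exprBn_pchar // exprZn -exprM /rlin -!mul_polyC /k projpE.
    rewrite -/x -/T [w ^+ r.+1]exprS !polyCD !polyCM mulnn; ring.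
  have -> : k%:P * ('X^q - iota c *: x) = (k%:P * x) ^+ q - iota c *: (k%:P * x).
    by rewrite exprMn -rmorphXn /= expf_card -!mul_polyC /x; ring.
  rewrite kx; move: (rlin w) fh fhr => H fH fHr.
  rewrite !exprBn_pchar // exprMn -rmorphXn /= expf_card; set j := a + _.
  case/negP.
  have -> : f ^+ q - (H ^+ r) ^+ q - j%:P * H ^+ q
               - iota c *: (f - H ^+ r - j%:P * H)
     = (f ^+ q - (iota c)%:P * f) - ((H ^+ q) ^+ r - iota c *: H ^+ r)
       - j%:P * (H ^+ q - iota c *: H).
    by rewrite [(H ^+ q) ^+ r]exprAC -!mul_polyC; ring.
  apply: dvdp_sub; last exact: dvdp_mull.
  apply: dvdp_sub; last exact: fHr.
  by apply: dvdp_sub; [rewrite -(prednK q_gt0) exprS dvdp_mulIl | rewrite dvdp_mulIr].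
(* [rlin w] divides both [f] and the remainder [p] of [G], so the norm of w is a root of y - c'. *)
split=> //; have : rlin w %| G.
  rewrite -(subrK p G) dvdp_add //; last by rewrite pE dvdp_mulIr.
  by apply: dvdp_trans dv; rewrite dvdp_rlin_fab.
by rewrite dvdp_rlin_cen map_polyXsubC root_XsubC => /eqP.
Qed.

(** * Roots of [projp] in F_q *)

Definition proj_roots : {set Fq} := [set v | root projp v]%SET.

Lemma card_proj_roots_le : (#|proj_roots| <= r.+1)%N.
Proof.
rewrite cardE -ltnS -size_projp; apply: max_poly_roots; rewrite ?enum_uniq //.
  by rewrite -size_poly_eq0 size_projp.
by apply/allP=> v; rewrite mem_enum inE.
Qed.

(** Both sides of the divisibility are X times a polynomial in X^(r-1), so it descends to [projp]
    and Y^M - c with M = (q-1)/(r-1). *)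
Lemma card_proj_roots_scalar (c : Fr) :
  c != 0 -> f %| cen ('X - c%:P) -> #|proj_roots| = r.+1.
Proof.
move=> nz_c; set M := (q.-1 %/ r.-1)%N.
have k_gt0 := predn_r_gt0; set k := r.-1 in k_gt0.
have rE : r = k.+1 by rewrite /k prednK.
have qE : q = (M * k).+1.
  by rewrite /M divnK ?(card_predn_dvd iota) // prednK.
have -> : f = 'X * (projp \Po 'X^k).
  rewrite /projp !comp_polyD comp_polyC comp_polyZ comp_polyX comp_Xn_poly.
  rewrite /fab -exprM -!mul_polyC.
  have -> : 'X^(r ^ 2) = 'X * 'X^(k * r.+1) :> {poly Fq}.
    by rewrite -exprS; congr ('X^_); rewrite rE; lia.
  by rewrite rE exprS -rE; ring.
have -> : cen ('X - c%:P) = 'X * (('X^M - (iota c)%:P) \Po 'X^k).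
  rewrite cenXsubC qE comp_polyB comp_polyC comp_Xn_poly exprS -exprM mulnC.
  by rewrite -!mul_polyC; ring.
rewrite dvdp_mul2l ?polyX_eq0 // => /dvdp_comp_Xn.
rewrite -size_poly_eq0 size_projp XnsubC_fiber // => /(_ k_gt0 isT).
(* A divisor of a product of distinct linear factors is a subproduct up to a unit: [ms] selects r +
   1 distinct roots of [projp]. *)
move=> /dvdp_prod_XsubC[ms ft_ms]; apply/eqP; rewrite eqn_leq card_proj_roots_le.
have : size (mask ms (enum (fiber c))) = r.+1.
  by apply: succn_inj; rewrite -size_projp (eqp_size ft_ms) size_prod_XsubC.
rewrite cardE => <-; apply: uniq_leq_size.
  by rewrite mask_uniq ?enum_uniq.
by move=> v v_in; rewrite mem_enum inE (eqp_root ft_ms) root_prod_XsubC.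
Qed.

Lemma proj_roots00 : a = 0 -> b = 0 -> proj_roots = [set 0 : Fq]%SET.
Proof.
move=> a0 b0; apply/setP=> v.
by rewrite !inE rootE projpE a0 b0 mul0r !addr0 expf_eq0.
Qed.

(** For b nonzero the characteristic polynomial serves. For a = b = 0, y^2 works because r <= q. For
    b = 0 and a nonzero, [projp] has the distinct roots 0 and w, and y(y - N(w)) works. *)
Lemma exists_quadratic_multiple :
  exists s, [/\ s \is monic, size s = 3%N & f %| cen s].
Proof.
have [b0|nz_b] := eqVneq b 0; last first.
  have [t [d fs]] := exists_charpoly nz_b.
  exists ('X^2 - t%:P * 'X + d%:P).
  have sz_low : (size (- (t%:P * 'X) + d%:P)%R < 3)%N.
    rewrite ltnS (leq_trans (size_polyD _ _)) // geq_max size_polyN.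
    rewrite mul_polyC (leq_trans (size_scale_leq _ _)) ?size_polyX //=.
    by rewrite (leq_trans (size_polyC_leq1 _)).
  split=> //; rewrite -addrA ?monicE.
    by rewrite lead_coefDl ?lead_coefXn // size_polyXn.
  by rewrite size_polyDl size_polyXn.
have [a0|nz_a] := eqVneq a 0.
  exists ('X * 'X); split; first by rewrite monicMl monicX.
    by rewrite -expr2 size_polyXn.
  rewrite cenXM cenX -exprM /fab a0 b0 !scale0r !addr0.
  by rewrite dvdp_exp2l // -mulnn leq_mul // (leq_card iota) //; apply: fmorph_inj.
have [n n_gt0 qE] := card_finField_expn iota.
(* The r-th root of -a, since q = r^n. *)
pose w := (- a) ^+ (r ^ n.-1).
have wr : w ^+ r = - a by rewrite -exprM -expnSr prednK // -qE expf_card.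
have nz_w : w != 0 by rewrite expf_eq0 oppr_eq0 (negPf nz_a) andbF.
have [c nw] := fqnorm_iota w.
have root0 : root projp 0 by rewrite rootE projpE b0 expr0n mulr0 !addr0.
have rootw : root projp w by rewrite rootE projpE exprS wr b0 addr0; apply/eqP; ring.
exists ('X * ('X - c%:P)).
rewrite monicMl ?monicXsubC ?monicX //; split=> //.
  by rewrite size_monicM ?monicX ?polyXsubC_eq0 // size_polyX size_XsubC.
rewrite (dvdp_fab_two_roots _ root0 rootw) 1?eq_sym // fqnorm0 nw.
rewrite rmorphM /= map_polyX map_polyXsubC !rootM !root_XsubC eqxx orbT andbT.
by rewrite rootX eqxx.
Qed.

Section MinimalPolynomial.
Variable m : {poly Fr}.
Hypotheses (mon_m : m \is monic) (fm : forall s, (f %| cen s) = (m %| s)).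

Lemma size_min_gt1 : (1 < size m)%N.
Proof.
rewrite ltnNge; apply/negP=> /size1_polyC mE.
have : m %| 1.
  have := mon_m; rewrite mE monicE lead_coefC => /eqP->.
  exact: dvdpp.
rewrite -fm -polyC1 cenC rmorph1 -(add0r (_ *: _)) -(scale0r 'X^r) dvdp_fab_low.
by rewrite oner_eq0 andbF.
Qed.

Lemma size_min_le3 : (size m <= 3)%N.
Proof.
have [s [mon_s <-]] := exists_quadratic_multiple.
by rewrite fm; apply/dvdp_leq/monic_neq0.
Qed.

Lemma root_proj_roots v : v \in proj_roots -> exists2 c, root m c & fqnorm v = iota c.
Proof.
rewrite inE -dvdp_rlin_fab => hf; have [c nv] := fqnorm_iota v; exists c => //.
have : rlin v %| cen m by rewrite (dvdp_trans hf) // fm.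
by rewrite dvdp_rlin_cen nv fmorph_root.
Qed.

(** Consequently, when [m] is quadratic, there is at most one root of each norm. *)
Lemma same_norm_proj_roots c v1 v2 :
    v1 \in proj_roots -> v2 \in proj_roots -> v1 != v2 ->
  fqnorm v1 = iota c -> fqnorm v2 = iota c -> m %| 'X - c%:P.
Proof.
rewrite !inE => r1 r2 ne12 n1 n2; rewrite -fm (dvdp_fab_two_roots _ r1 r2 ne12) n1 n2.
by rewrite map_polyXsubC root_XsubC eqxx.
Qed.

Lemma cubic_size_ndvdp c : size m = 3%N -> ~~ (f %| cen ('X - c%:P)).
Proof.
move=> sz_m; rewrite fm; apply/negP=> /dvdp_leq.
by rewrite polyXsubC_eq0 sz_m size_XsubC => /(_ isT).
Qed.

Lemma card_proj_roots_irreducible :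
  irreducible_poly m -> size m = 3%N -> #|proj_roots| = 0%N.
Proof.
move=> [_ irr_m] sz_m; apply: eq_card0 => v; apply/negP=> /root_proj_roots[c].
rewrite -dvdp_XsubCl => /irr_m; rewrite size_XsubC => /(_ isT) /eqp_size.
by rewrite size_XsubC sz_m.
Qed.

(** A root exists by [cen_quadratic_root]. Every root has norm c, and two of them would make [m]
    divide y - c. *)
Lemma card_proj_roots_square c :
  m = ('X - c%:P) * ('X - c%:P) -> #|proj_roots| = 1%N.
Proof.
move=> mE; have sz_m : size m = 3%N by rewrite mE size_mul_XsubC.
have nf := cubic_size_ndvdp c sz_m.
have fcc : f %| cen (('X - c%:P) * ('X - c%:P)) by rewrite -mE fm.
have [w [rw nw]] := cen_quadratic_root fcc nf nf.
apply/eqP/cards1P; exists w; apply/setP=> v; rewrite finset.in_set1.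
apply/idP/eqP=> [v_r|->]; last by rewrite inE.
have w_r : w \in proj_roots by rewrite inE.
have [d] := root_proj_roots v_r; rewrite mE rootM orbb root_XsubC => /eqP-> nv.
by apply: contraNeq nf => ne; rewrite fm (same_norm_proj_roots v_r w_r ne nv nw).
Qed.

Lemma card_proj_roots_distinct c c' :
  c != c' -> m = ('X - c%:P) * ('X - c'%:P) -> #|proj_roots| = 2%N.
Proof.
move=> ne_c mE; have sz_m : size m = 3%N by rewrite mE size_mul_XsubC.
have nf d := cubic_size_ndvdp d sz_m.
have fcc : f %| cen (('X - c%:P) * ('X - c'%:P)) by rewrite -mE fm.
have [w' [rw' nw']] := cen_quadratic_root fcc (nf c) (nf c').
rewrite mulrC in fcc; have [w [rw nw]] := cen_quadratic_root fcc (nf c') (nf c).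
have ne_w : w != w'.
  by apply: contraNneq ne_c => ww; rewrite -(inj_eq (fmorph_inj iota)) -nw ww nw'.
have -> : proj_roots = [set w; w']%SET; last by rewrite cards2 ne_w.
have w_r : w \in proj_roots by rewrite inE.
have w'_r : w' \in proj_roots by rewrite inE.
apply/setP=> v; rewrite finset.in_set2; apply/idP/orP=> [v_r|[]/eqP-> //].
have [d] := root_proj_roots v_r; rewrite mE rootM !root_XsubC => /orP[]/eqP-> nv.
  left; apply: contraNT (nf c) => ne.
  by rewrite fm (same_norm_proj_roots v_r w_r ne nv nw).
right; apply: contraNT (nf c') => ne.
by rewrite fm (same_norm_proj_roots v_r w'_r ne nv nw').
Qed.

(** [m] has degree 1 or 2. The cases m = y and m = y^2 make [f] divide a power of X, so they lead to
    f = X^(r^2), the exceptional member of the second case. *)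
Lemma min_poly_cases :
  [\/ size m = 3%N /\ irreducible_poly m,
      (a = 0 /\ b = 0) \/ exists2 c, c != 0 & m = ('X - c%:P) * ('X - c%:P),
      exists c c', c != c' /\ m = ('X - c%:P) * ('X - c'%:P) |
      exists2 c, c != 0 & m = 'X - c%:P].
Proof.
have linear s : s \is monic -> size s = 2%N -> exists c, s = 'X - c%:P.
  move=> mon_s /size2_XsubC[c sE]; exists c.
  by rewrite {1}sE (monicP mon_s) scale1r.
have fXq i : m %| 'X^i -> a = 0 /\ b = 0.
  rewrite -fm; have -> : cen 'X^i = 'X^(q ^ i).
    elim: i => [|i IHi]; first by rewrite expr0 -polyC1 cenC rmorph1 scale1r.
    by rewrite exprS cenXM IHi -exprM expnSr.
  exact: dvdp_fab_Xn.
have := size_min_gt1; have := size_min_le3.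
case sz_m: (size m) => [|[|[|[|//]]]] // _ _.
  have [c mE] := linear _ mon_m sz_m.
  have [c0|nz_c] := eqVneq c 0; last by constructor 4; exists c.
  by constructor 2; left; apply: (fXq 1%N); rewrite mE c0 subr0.
have [[c rc]|nr] := pselect (exists c, root m c); last first.
  constructor 1; split=> //; apply: cubic_irreducible; first by rewrite sz_m.
  by move=> c; apply/negP=> rc; apply: nr; exists c.
have /dvdpP[u mE] : 'X - c%:P %| m by rewrite dvdp_XsubCl.
have mon_u : u \is monic by rewrite -(monicMr _ (monicXsubC c)) -mE.
have sz_u : size u = 2%N.
  move: sz_m; rewrite mE size_monicM ?monicXsubC ?polyXsubC_eq0 // size_XsubC.
  by rewrite addn2 => -[].
have [c' uE] := linear _ mon_u sz_u; rewrite uE in mE.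
have [cc|ne_c] := eqVneq c' c; last by constructor 3; exists c', c.
rewrite cc in mE.
have [c0|nz_c] := eqVneq c 0; last by constructor 2; right; exists c.
by constructor 2; left; apply: (fXq 2%N); rewrite mE c0 subr0 -expr2.
Qed.

End MinimalPolynomial.

End FixedCoefficients.
End AdditiveTrinomials.

(** * Collisions *)

Section Collisions.
Variables (Fr Fq : finFieldType) (iota : {rmorphism Fr -> Fq}).
Notation r := #|Fr|.
Notation q := #|Fq|.
Notation rlin := (rlin Fr).
Notation proj_roots := (proj_roots Fr).
Implicit Types (a b u v : Fq) (P g k : {poly Fq}).

Let r_gt1 : (1 < r)%N := finNzRing_gt1 Fr.
Let r_gt0 : (0 < r)%N := ltnW r_gt1.
Let pnat_r := pnat_card_poly iota.

Lemma additive_rlin u : additive_poly r (rlin u).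
Proof.
have -> : rlin u = 1 *: 'X^(r ^ 1) + (- u) *: 'X^(r ^ 0) by rewrite scale1r scaleNr.
by apply: additiveD; apply: additive_monomial.
Qed.

Lemma additive_degree_r P :
  additive_poly r P -> P \is monic -> size P = r.+1 -> exists u, P = rlin u.
Proof.
move=> [n [c PE]] mon_P sz_P; exists (- P`_1); apply/polyP=> j.
rewrite coefB coefZ coefXn coefX mulNr opprK.
have [->|ne_jr] := eqVneq j r.
  rewrite (gtn_eqF r_gt1) mulr0 addr0.
  by have := monicP mon_P; rewrite lead_coefE sz_P.
rewrite add0r; have [->|ne_j1] := eqVneq j 1%N; first by rewrite mulr1.
rewrite mulr0; have [le_j|lt_j] := leqP (size P) j; first by rewrite nth_default.
rewrite PE coef_sum big1 // => i _; rewrite coefZ coefXn.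
case: eqP => [jE|]; last by rewrite mulr0.
case: i jE => [[|[|i]] _] /= jE; first by rewrite jE eqxx in ne_j1.
  by rewrite jE expn1 eqxx in ne_jr.
move: lt_j; rewrite sz_P ltnS jE -{2}(expn1 r) leq_exp2l //.
Qed.

Lemma comp_rlin u v : rlin u \Po rlin v = fab r (- (u + v ^+ r)) (u * v).
Proof.
rewrite /rlin comp_polyB comp_polyZ comp_Xn_poly comp_polyX exprBn_pchar //.
by rewrite exprZn -exprM mulnn /fab -!mul_polyC polyCN polyCD polyCM; ring.
Qed.

Lemma fab_inj a b a' b' : fab r a b = fab r a' b' :> {poly Fq} -> a = a' /\ b = b'.
Proof.
move=> fE; have : fab r a b %| (a - a') *: 'X^r + (b - b') *: 'X.
  have -> : (a - a') *: 'X^r + (b - b') *: 'X = fab r a b - fab r a' b' :> {poly Fq}.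
    by rewrite /fab -!mul_polyC !polyCB; ring.
  by rewrite -fE subrr dvdp0.
by rewrite dvdp_fab_low !subr_eq0 => /andP[/eqP-> /eqP->].
Qed.

Lemma mem_proj_roots a b v : (v \in proj_roots a b) = (v ^+ r.+1 + a * v + b == 0).
Proof. by rewrite inE rootE projpE. Qed.

(** The left factor is forced by the coefficient of X^r in [comp_rlin]. *)
Definition decomposition a b v : {poly Fq} * {poly Fq} :=
  (rlin (- (a + v ^+ r)), rlin v).

Lemma decompositionP a b g k :
  ([/\ additive_poly r g, g \is monic & size g = r.+1] /\
   [/\ additive_poly r k, k \is monic & size k = r.+1] /\ g \Po k = fab r a b)
  <-> exists2 v, v \in proj_roots a b & (g, k) = decomposition a b v.
Proof.
split=> [[[ag mg sg] [[ak mk sk]]]|[v]].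
  have [u ->] := additive_degree_r ag mg sg.
  have [v ->] := additive_degree_r ak mk sk.
  rewrite comp_rlin => /fab_inj[aE bE]; exists v.
    by rewrite mem_proj_roots -aE -bE exprS; apply/eqP; ring.
  by rewrite /decomposition -aE; congr (rlin _, _); ring.
rewrite mem_proj_roots => /eqP rv [-> ->].
do 2![split; first by split; rewrite ?size_rlin ?rlin_monic //; apply: additive_rlin].
rewrite comp_rlin; congr fab; first by ring.
by apply/eqP; rewrite -subr_eq0 -oppr_eq0 -rv exprS; apply/eqP; ring.
Qed.

Local Open Scope fset_scope.

Definition decompositions a b : {fset {poly Fq} * {poly Fq}} :=
  [fset x in [seq decomposition a b v | v <- enum (proj_roots a b)]].

Lemma rlin_inj : injective (fun v : Fq => rlin v).
Proof.
move=> u v /(congr1 (fun P : {poly Fq} => P`_1)) /=.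
rewrite !coefB !coefZ !coefXn !coefX eqxx [(1 == r)%N]eq_sym (gtn_eqF r_gt1) /=.
by rewrite !mulr1 => /addrI/oppr_inj.
Qed.

Lemma card_decompositions a b : #|` decompositions a b| = #|proj_roots a b|.
Proof.
rewrite card_fseq undup_id ?size_map -?cardE //.
by rewrite map_inj_uniq ?enum_uniq // => u v [_ /rlin_inj].
Qed.

Lemma collisionP i a b S :
  collision r i (fab r a b) S <-> #|` S| = i /\ S `<=` decompositions a b.
Proof.
split=> -[sz_S sub_S]; split=> //.
  apply/fsubsetP=> -[g k] /sub_S /decompositionP[v rv ->].
  by rewrite in_fset map_f ?mem_enum.
move=> g k /(fsubsetP sub_S); rewrite in_fset => /mapP[v]; rewrite mem_enum => rv gk.
by apply/decompositionP; exists v.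
Qed.

(** Collisions are the subsets of [decompositions a b]; a proper subset can be enlarged by one
    element, so only the full set is maximal. *)
Lemma has_maximal_collisionP i a b :
  has_maximal_collision r i (fab r a b) <-> #|proj_roots a b| = i.
Proof.
rewrite -card_decompositions; split=> [[S [/collisionP[<- sub_S] max_S]]|<-].
  suff -> : S = decompositions a b by [].
  apply/eqP; rewrite eqEfsubset sub_S; apply/fsubsetP=> x Dx.
  apply: contraT => nSx; case: max_S; exists (x |` S).
  rewrite fsubsetUr; split=> //; apply/collisionP.
  by rewrite cardfsU1 nSx fsubUset fsub1set Dx.
exists (decompositions a b); split; first exact/collisionP.
move=> [T [/collisionP[sz_T /fsubset_leq_card]]].
by rewrite sz_T ltnn.
Qed.

Lemma mem_collision_set i a b :
  ((a, b) \in collision_set Fq r i) = (#|proj_roots a b| == i).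
Proof.
by rewrite inE /=; apply/asboolP/eqP => /has_maximal_collisionP.
Qed.

End Collisions.

(** * Counting *)

Section Counting.
Variables (Fr Fq : finFieldType) (iota : {rmorphism Fr -> Fq}).
Notation r := #|Fr|.
Notation q := #|Fq|.
Notation rlin := (rlin Fr).
Notation proj_roots := (proj_roots Fr).
Notation fqnorm := (fqnorm Fr).
Notation cen := (cen iota).
Implicit Types (a b u v : Fq).

Let r_gt1 : (1 < r)%N := finNzRing_gt1 Fr.
Let q_gt1 : (1 < q)%N := finNzRing_gt1 Fq.

Lemma min_poly_fab a b : exists m : {poly Fr},
  [/\ m \is monic, min_central iota r q (fab r a b) = cen m &
      forall s, (fab r a b %| cen s) = (m %| s)].
Proof.
have [s [mon_s _ fs]] := exists_quadratic_multiple iota a b.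
by apply: min_centralP; exists s.
Qed.

Lemma card_proj_roots_cases a b : #|proj_roots a b| \in [:: 0; 1; 2; r.+1]%N.
Proof.
have [m [mon_m _ fm]] := min_poly_fab a b.
rewrite !inE; have [[sz irr]|[[a0 b0]|[c _ mE]]|[c [c' [ne mE]]]|[c nz mE]] :=
  min_poly_cases mon_m fm.
- by rewrite (card_proj_roots_irreducible fm).
- by rewrite proj_roots00 // cards1.
- by rewrite (card_proj_roots_square fm mE).
- by rewrite (card_proj_roots_distinct fm ne mE).
- rewrite (card_proj_roots_scalar (c := c) (iota := iota)) ?eqxx ?orbT //.
  by rewrite fm mE dvdpp.
Qed.

(** Two distinct roots leave only the counts 2 and r + 1. In the latter case [m] is linear and all
    norms agree; equal norms conversely put [f] in the scalar case. *)
Lemma fqnorm_neq_proj_roots a b u v :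
    u != v -> u \in proj_roots a b -> v \in proj_roots a b ->
  (fqnorm u != fqnorm v) = (#|proj_roots a b| == 2%N).
Proof.
move=> ne_uv ru rv; have [m [mon_m _ fm]] := min_poly_fab a b.
have gt1 : (1 < #|proj_roots a b|)%N.
  have -> : 2%N = #|[set u; v]%SET| by rewrite cards2 ne_uv.
  by apply/subset_leq_card/fintype.subsetP=> w;
     rewrite finset.in_set2 => /orP[]/eqP->.
apply/idP/eqP => [ne_n|c2].
  have [[sz irr]|[[a0 b0]|[c _ mE]]|[c [c' [ne mE]]]|[c nz mE]] :=
    min_poly_cases mon_m fm.
  - by rewrite (card_proj_roots_irreducible fm) in gt1.
  - by rewrite proj_roots00 // cards1 in gt1.
  - by rewrite (card_proj_roots_square fm mE) in gt1.
  - exact: (card_proj_roots_distinct fm ne mE).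
  have [d1 + n1] := root_proj_roots fm ru; have [d2 + n2] := root_proj_roots fm rv.
  rewrite mE !root_XsubC => /eqP d2c /eqP d1c.
  by rewrite n1 n2 d1c d2c eqxx in ne_n.
apply: contraTneq (isT) => eq_n.
have [c nu] := fqnorm_iota iota u.
have nv : fqnorm v = iota c by rewrite -eq_n.
have fc : fab r a b %| cen ('X - c%:P) by rewrite fm (same_norm_proj_roots fm ru rv).
(* A common norm 0 would give u = v = 0. *)
have [c0|nz_c] := eqVneq c 0.
  move: nu nv ne_uv; rewrite c0 rmorph0 => /eqP + /eqP.
  by rewrite !(fqnorm_eq0 iota) => /eqP-> /eqP->; rewrite eqxx.
have := card_proj_roots_scalar nz_c fc; rewrite c2 => -[rE].
by move: r_gt1; rewrite -rE.
Qed.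

(** Double counting: given v and a, exactly one b makes v a root. *)
Lemma sum_card_proj_roots : (\sum_(ab : Fq * Fq) #|proj_roots ab.1 ab.2| = q * q)%N.
Proof.
transitivity (\sum_(v : Fq) \sum_(ab : Fq * Fq) (v \in proj_roots ab.1 ab.2))%N.
  rewrite exchange_big; apply: eq_bigr => ab _.
  by rewrite -sum1_card big_mkcond; apply: eq_bigr => v _; case: (v \in _).
rewrite -sum_nat_const; apply: eq_bigr => v _.
rewrite -(pair_bigA _ (fun a b => (v \in proj_roots a b) : nat)) /=.
rewrite -sum1_card; apply: eq_bigr => a _.
rewrite (bigD1 (- (v ^+ r.+1 + a * v))) //= mem_proj_roots subrr eqxx big1 // => b.
by rewrite mem_proj_roots addr_eq0 [_ == - b]eq_sym eqr_oppLR => /negPf->.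
Qed.

(** The two root conditions are linear in (a, b) with determinant u - v. *)
Lemma card_through_two u v : u != v ->
  #|[set ab : Fq * Fq |
      (u \in proj_roots ab.1 ab.2) && (v \in proj_roots ab.1 ab.2)]%SET| = 1%N.
Proof.
move=> ne_uv; have nz_uv : u - v != 0 by rewrite subr_eq0.
pose a0 := - (u ^+ r.+1 - v ^+ r.+1) / (u - v).
have a0E : a0 * (u - v) = - (u ^+ r.+1 - v ^+ r.+1) by rewrite divfK.
apply/eqP/cards1P; exists (a0, - (u ^+ r.+1 + a0 * u)); apply/setP=> -[a b].
rewrite finset.in_set1 inE /= !mem_proj_roots xpair_eqE.
apply/andP/andP=> -[/eqP e1 /eqP e2].
  have aE : a = a0.
    apply: (mulIf nz_uv); rewrite a0E; apply/eqP; rewrite -subr_eq0 -(subrr 0).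
    by rewrite -{1}e1 -e2; apply/eqP; ring.
  by rewrite aE; split=> //; rewrite -addr_eq0 addrC -aE e1.
rewrite e1 e2 subrr; split=> //.
by rewrite -[X in _ == X](subrr (a0 * (u - v))) {1}a0E; apply/eqP; ring.
Qed.

(** Double counting by [card_through_two]; [Q] is instantiated both with distinctness and with
    distinctness of norms. *)
Lemma sum_pairs_proj_roots (Q : pred (Fq * Fq)) : (forall p, Q p -> p.1 != p.2) ->
  (\sum_(ab : Fq * Fq)
      #|[set p | [&& Q p, p.1 \in proj_roots ab.1 ab.2
                        & p.2 \in proj_roots ab.1 ab.2]]%SET|
    = #|Q|)%N.
Proof.
move=> neQ.
transitivity (\sum_(ab : Fq * Fq) \sum_(p | Q p)
   ((p.1 \in proj_roots ab.1 ab.2) && (p.2 \in proj_roots ab.1 ab.2)))%N.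
  apply: eq_bigr => ab _; rewrite -sum1dep_card big_mkcondr /=.
  by apply: eq_bigr => p _; case: (_ && _).
rewrite exchange_big -sum1_card; apply: eq_bigr => p Qp.
rewrite -[RHS](card_through_two (neQ p Qp)) -sum1dep_card [RHS]big_mkcond /=.
by apply: eq_bigr => ab _; case: (_ && _).
Qed.

(** Counts the complement: 0 shares its norm only with itself, and each of the q - 1 nonzero
    elements lies in a fibre of size (q-1)/(r-1). *)
Lemma card_fqnorm_neq :
  (#|[set p : Fq * Fq | fqnorm p.1 != fqnorm p.2]%SET|
     + (1 + q.-1 * (q.-1 %/ r.-1)) = q * q)%N.
Proof.
rewrite -[RHS](card_prod Fq Fq).
rewrite -(cardsC [set p : Fq * Fq | fqnorm p.1 != fqnorm p.2]%SET).
congr (_ + _)%N.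
transitivity (\sum_(u : Fq) #|[set v | fqnorm v == fqnorm u]%SET|)%N; last first.
  under eq_bigr => u _ do rewrite -sum1dep_card.
  rewrite pair_big_dep /= -sum1_card; apply: eq_bigl => p.
  by rewrite !inE negbK eq_sym.
rewrite (bigD1 0) //=; congr (_ + _)%N.
  by rewrite -(card_fiber0 iota) /fiber (fqnorm0 iota) rmorph0.
rewrite -(cardC1 (0 : Fq)) -sum_nat_const; apply: eq_big => // u nz_u.
have [c nu] := fqnorm_iota iota u.
have nz_c : c != 0 by rewrite -(fmorph_eq0 iota) -nu (fqnorm_eq0 iota).
by rewrite nu -/(fiber iota c) card_fiber // cardC1.
Qed.

Notation n_ i := #|collision_set Fq r i|.

Lemma sum_by_card_proj_roots (F : nat -> nat) :
  (\sum_(ab : Fq * Fq) F #|proj_roots ab.1 ab.2|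
     = n_ 0 * F 0 + n_ 1 * F 1 + n_ 2 * F 2 + n_ r.+1 * F r.+1)%N.
Proof.
have nE i : (n_ i * F i = \sum_(ab : Fq * Fq) (#|proj_roots ab.1 ab.2| == i) * F i)%N.
  rewrite -big_distrl /= -sum1_card big_mkcond; congr (_ * _)%N.
  by apply: eq_bigr => -[a b] _; rewrite (mem_collision_set iota); case: (_ == i).
rewrite !nE -!big_split; apply: eq_bigr => -[a b] _ /=.
have := card_proj_roots_cases a b; rewrite !inE => /or4P[]/eqP->; move: r_gt1;
  case: #|Fr| => [|[|s]] // _; rewrite ?mul0n ?mul1n ?addn0 //.
by rewrite eqxx mul1n.
Qed.

Lemma collision_count0 : (n_ 0 + n_ 1 + n_ 2 + n_ r.+1 = q * q)%N.
Proof.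
have := sum_by_card_proj_roots (fun=> 1%N); rewrite !muln1 => <-.
by rewrite sum1_card card_prod.
Qed.

Lemma collision_count1 : (n_ 1 + n_ 2 * 2 + n_ r.+1 * r.+1 = q * q)%N.
Proof.
have := sum_by_card_proj_roots id; rewrite muln0 muln1 => <-.
exact: sum_card_proj_roots.
Qed.

Lemma collision_count2 : (n_ 2 * 2 + n_ r.+1 * (r.+1 * r) = q * q.-1)%N.
Proof.
have := sum_by_card_proj_roots (fun k => k * k.-1)%N; rewrite !muln0 /= => <-.
rewrite -[q in RHS]cardsT -card_distinct_pairs.
under eq_bigr => ab _ do rewrite -card_distinct_pairs.
rewrite (@sum_pairs_proj_roots [pred p | p.1 != p.2]) //.
by apply: eq_card => p; rewrite !inE !andbT.
Qed.

Lemma collision_count_neq :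
  (n_ 2 * 2 + (1 + q.-1 * (q.-1 %/ r.-1)) = q * q)%N.
Proof.
rewrite -card_fqnorm_neq; congr (_ + _)%N.
(* This weight keeps only the (a, b) with two roots, each contributing two ordered pairs. *)
have := sum_by_card_proj_roots (fun k => (k == 2) * (k * k.-1))%N.
rewrite !mul0n !muln0 /= (gtn_eqF (_ : 2 < r.+1)%N) // mul0n muln0 addn0 !add0n => <-.
pose Q : pred (Fq * Fq) := [pred p | fqnorm p.1 != fqnorm p.2].
have -> : #|[set p : Fq * Fq | fqnorm p.1 != fqnorm p.2]%SET| = #|Q|.
  by apply: eq_card => p; rewrite inE.
rewrite -(@sum_pairs_proj_roots Q); last first.
  by move=> p /=; apply: contraNneq => ->.
apply: eq_bigr => -[a b] _ /=; rewrite -card_distinct_pairs.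
(* For fixed (a, b), the root pairs of distinct norms are all pairs of distinct roots or none,
   according to whether there are exactly two roots. *)
have QE u v : [&& Q (u, v), u \in proj_roots a b & v \in proj_roots a b] =
    [&& #|proj_roots a b| == 2%N, u != v, u \in proj_roots a b & v \in proj_roots a b].
  rewrite /Q /=; have [ru|] := boolP (u \in proj_roots a b); last by rewrite !andbF.
  have [rv|] := boolP (v \in proj_roots a b); last by rewrite !andbF.
  have [->|ne] := eqVneq u v; first by rewrite eqxx !andbF.
  by rewrite (fqnorm_neq_proj_roots ne ru rv) !andbT.
case: (#|proj_roots a b| == 2%N) QE => QE; rewrite ?mul1n ?mul0n.
  apply: eq_card => -[u v]; rewrite finset.in_set [RHS]finset.in_set.
  exact: esym (QE u v).
by apply/esym/eq_card0 => -[u v]; rewrite finset.in_set; exact: QE.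
Qed.

(** * Number of decompositions in terms of f^* *)

Section Classification.
Variables a b : Fq.
Let fstar := min_central iota r q (fab r a b).

Let r_neq : (r.+1 != 0) && (r.+1 != 1) && (r.+1 != 2)%N.
Proof. by case: #|Fr| r_gt1 => [|[]]. Qed.

Lemma size_cen_q (s : {poly Fr}) n :
  size (cen s) = (q ^ n).+1 <-> size s = n.+1.
Proof.
have [->|nz_s] := eqVneq s 0; first by rewrite cen0 !size_poly0.
rewrite size_cen //; split=> [[]|->] // /eqP.
by rewrite eqn_exp2l // => /eqP <-; rewrite prednK // lt0n size_poly_eq0.
Qed.

Lemma card_proj_roots_fstar :
  [/\ #|proj_roots a b| = 0%N <->
        exists m, [/\ fstar = cen m, size m = 3%N & irreducible_poly m],
      #|proj_roots a b| = 1%N <-> (a = 0 /\ b = 0) \/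
        exists2 c, c != 0 & fstar = cen (('X - c%:P) * ('X - c%:P)),
      #|proj_roots a b| = 2%N <->
        exists c c', c != c' /\ fstar = cen (('X - c%:P) * ('X - c'%:P)) &
      #|proj_roots a b| = r.+1 <-> exists2 c, c != 0 & fstar = cen ('X - c%:P)].
Proof.
have [m [mon_m fsE fm]] := min_poly_fab a b.
rewrite /fstar fsE.
have K0 : (exists m', [/\ cen m = cen m', size m' = 3%N & irreducible_poly m']) ->
    #|proj_roots a b| = 0%N.
  by move=> [m' [/cen_inj <- sz irr]]; apply: card_proj_roots_irreducible fm irr sz.
have K1 : (a = 0 /\ b = 0) \/
      (exists2 c, c != 0 & cen m = cen (('X - c%:P) * ('X - c%:P))) ->
    #|proj_roots a b| = 1%N.
  move=> [[a0 b0]|[c _ /cen_inj mE]]; first by rewrite proj_roots00 ?cards1.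
  exact: (card_proj_roots_square fm mE).
have K2 : (exists c c', c != c' /\ cen m = cen (('X - c%:P) * ('X - c'%:P))) ->
    #|proj_roots a b| = 2%N.
  by move=> [c [c' [ne /cen_inj mE]]]; apply: (card_proj_roots_distinct fm ne mE).
have K3 : (exists2 c, c != 0 & cen m = cen ('X - c%:P)) -> #|proj_roots a b| = r.+1.
  move=> [c nz /cen_inj mE]; apply: (card_proj_roots_scalar (iota := iota) nz).
  by rewrite fm mE dvdpp.
have /andP[/andP[/eqP r0 /eqP r1] /eqP r2] := r_neq.
apply: (iff_partition K0 K1 K2 K3) => //.
have [[sz irr]|k|[c [c' [ne mE]]]|[c nz mE]] := min_poly_cases mon_m fm.
- by constructor 1; exists m.
- by constructor 2; case: k => [|[c nz ->]]; [left | right; exists c].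
- by constructor 3; exists c, c'; rewrite mE.
by constructor 4; exists c; rewrite ?mE.
Qed.

End Classification.

Lemma collision_counts (rr := r%:R : rat) (qq := q%:R : rat) :
  [/\ (n_ 0)%:R = rr * (qq ^+ 2 - 1) / (2 * (rr + 1)),
      (n_ 1)%:R = (qq ^+ 2 - qq) / rr + 1,
      (n_ 2)%:R = (qq - 1) ^+ 2 * (rr - 2) / (2 * (rr - 1)) + qq - 1,
      (n_ r.+1)%:R = (qq - 1) * (qq - rr) / (rr * (rr ^+ 2 - 1)) &
      (n_ 0)%:R + (n_ 1)%:R + (n_ 2)%:R + (n_ r.+1)%:R = qq ^+ 2].
Proof.
have toQ (m k : nat) : m = k -> m%:R = k%:R :> rat by move->.
have E0 := toQ _ _ collision_count0; have E1 := toQ _ _ collision_count1.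
have E2 := toQ _ _ collision_count2; have E3 := toQ _ _ collision_count_neq.
have EM : ((q.-1 %/ r.-1)%:R : rat) * (rr - 1) = qq - 1.
  have r1 : rr - 1 = (r.-1)%:R by rewrite -subn1 natrB // ltnW.
  have q1 : qq - 1 = (q.-1)%:R by rewrite -subn1 natrB // ltnW.
  by rewrite r1 q1 -natrM divnK // (card_predn_dvd iota).
have q1 : (q.-1)%:R = qq - 1 :> rat by rewrite -subn1 natrB // ltnW.
rewrite !(natrM, natrD, natrX, q1, natr1) in E0 E1 E2 E3.
rewrite -!natr1 -/rr -/qq in E0 E1 E2 E3.
move: E0 E1 E2 E3 EM.
have nz_r : rr != 0 by rewrite Num.Theory.pnatr_eq0 -lt0n ltnW.
have nz_r1 : rr + 1 != 0 by rewrite natr1 Num.Theory.pnatr_eq0.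
have nz_r2 : rr - 1 != 0.
  by rewrite subr_eq0 (Num.Theory.eqr_nat _ r 1) gtn_eqF.
move: (n_ 0)%:R (n_ 1)%:R (n_ 2)%:R (n_ r.+1)%:R (_ %/ _)%:R nz_r nz_r1 nz_r2.
clear q1; move: rr qq => R Q x0 x1 x2 x3 M nz_R nz_R1 nz_R2 E0 E1 E2 E3 EM.
have nz_2 : 2 != 0 :> rat by [].
have nz_R3 : R ^+ 2 - 1 != 0.
  by have -> : R ^+ 2 - 1 = (R - 1) * (R + 1); [ring | rewrite mulf_neq0].
have ME : M = (Q - 1) / (R - 1) by rewrite -EM mulfK.
(* The four equations are triangular: the norm count gives [x2], the pair count [x3], the root count
   [x1] and the total [x0]. *)
have x2E : x2 = (Q * Q - 1 - (Q - 1) * M) / 2.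
  by apply: (mulIf nz_2); rewrite divfK // -E3; ring.
have x3E : x3 = (Q * (Q - 1) - x2 * 2) / ((R + 1) * R).
  by apply: (mulIf (mulf_neq0 nz_R1 nz_R)); rewrite divfK ?mulf_neq0 // -E2; ring.
have x1E : x1 = Q * Q - x2 * 2 - x3 * (R + 1) by rewrite -E1; ring.
have x0E : x0 = Q * Q - x1 - x2 - x3 by rewrite -E0; ring.
split; last by rewrite E0 expr2.
- by rewrite x0E x1E x3E x2E ME; field; rewrite nz_R nz_R1.
- by rewrite x1E x3E x2E ME; field; rewrite nz_R nz_R1.
- by rewrite x2E ME; field.
by rewrite x3E x2E ME; field; rewrite nz_R3 nz_R nz_R1.
Qed.

End Counting.

Theorem theorem5p2 (Fr Fq : finFieldType) (iota : {rmorphism Fr -> Fq})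
    (r q : nat) (hr : #|Fr| = r) (hq : #|Fq| = q) :
  let C := collision_set Fq r in
  let fstar := fun a b : Fq => min_central iota r q (fab r a b) in
  let central := central_poly iota q in
  let tauq := @tau Fr Fq iota q in
  let c := fun i : nat => #|C i|%:R : rat in
  let rr : rat := r%:R in
  let qq : rat := q%:R in
  (* Case 0 *)
  [/\ (forall a b : Fq, (a, b) \in C 0%N <->
         [/\ central (fstar a b), size (fstar a b) = (q ^ 2).+1 &
             ~ exists gs hs : {poly Fq},
                 [/\ central gs, central hs, size gs = q.+1, size hs = q.+1 &
                     fstar a b = gs \Po hs]]),
      (forall a b : Fq, (a, b) \in C 0%N <->
         (size (tauq (fstar a b)) = 3%N /\
          irreducible_poly (tauq (fstar a b)))) &
      c 0%N = rr * (qq ^+ 2 - 1) / (2 * (rr + 1))]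
  /\
  (* Case 1; the source omits f = x^(r^2), i.e. (a, b) = (0, 0), from this
     description although c_1 counts it *)
  ((forall a b : Fq, (a, b) \in C 1%N <->
      ((a = 0 /\ b = 0) \/
       exists2 c0 : Fr, c0 != 0 &
         fstar a b = ('X^q - iota c0 *: 'X) \Po ('X^q - iota c0 *: 'X))) /\
   c 1%N = (qq ^+ 2 - qq) / rr + 1)
  /\
  (* Case 2 *)
  ((forall a b : Fq, (a, b) \in C 2%N <->
      exists gs hs : {poly Fq},
        [/\ central gs /\ central hs, size gs = q.+1, size hs = q.+1,
            coprimep (tauq gs) (tauq hs) & fstar a b = gs \Po hs]) /\
   c 2%N = (qq - 1) ^+ 2 * (rr - 2) / (2 * (rr - 1)) + qq - 1)
  /\
  (* Case r+1 *)
  ((forall a b : Fq, (a, b) \in C r.+1 <->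
      exists2 c0 : Fr, c0 != 0 & fstar a b = 'X^q + iota c0 *: 'X) /\
   c r.+1 = (qq - 1) * (qq - rr) / (rr * (rr ^+ 2 - 1)))
  /\
  c 0%N + c 1%N + c 2%N + c r.+1 = qq ^+ 2
  /\
  (forall i : nat, i \notin [:: 0; 1; 2; r.+1]%N -> C i = finset.set0).
Proof.
subst r q => C fstar central tauq c rr qq.
have [c0 c1 c2 c3 csum] := collision_counts iota.
have memC i a b : ((a, b) \in C i) <-> #|proj_roots Fr a b| = i.
  by rewrite (mem_collision_set iota); split=> /eqP.
have min_ab a b := min_poly_fab iota a b.
have irr_factor (m s t : {poly Fr}) :
    irreducible_poly m -> size m = 3%N -> m = s * t -> size s <> 2%N.
  move=> [_ irr] sz_m mE sz_s.
  have /eqp_size : s %= m by apply: irr; rewrite ?sz_s // mE dvdp_mulr.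
  by rewrite sz_m sz_s.
split.
  split; last exact: c0; move=> a b; have [m [mon_m fsE fm]] := min_ab a b;
    have [K0 _ _ _] := card_proj_roots_fstar iota a b.
  - split=> [/memC/K0[m' [+ sz irr]]|[cent sz no_dec]].
      rewrite /fstar => ->; split; first by apply/central_polyP; exists m'.
        exact/(size_cen_q iota).
      case=> gs [hs [/central_polyP[s ->] /central_polyP[t ->]]].
      move=> /(size_cen_q iota _ 1) sz_s _; rewrite -cenM => /cen_inj mE.
      exact: (irr_factor _ _ _ irr sz mE).
    apply/memC/K0; exists m; move: sz; rewrite /fstar fsE => /size_cen_q sz_m.
    (* A root of [m] would split off a linear factor and so yield a forbidden composition. *)
    split=> //; apply: cubic_irreducible; rewrite ?sz_m // => x.
    apply/negP; rewrite -dvdp_XsubCl => /dvdpP[u mE]; apply: no_dec.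
    have sz_u : size u = 2%N.
      have nz_u : u != 0.
        apply: contraTneq (monic_neq0 mon_m) => u0.
        by rewrite mE u0 mul0r eqxx.
      by move: sz_m; rewrite mE size_Mmonic ?monicXsubC // size_XsubC addn2 => -[].
    exists (cen iota u), (cen iota ('X - x%:P)).
    rewrite /fstar fsE -cenM -mE.
    by split=> //; [apply/central_polyP; exists u
      | apply/central_polyP; exists ('X - x%:P)
      | apply/(size_cen_q iota _ 1) | apply/(size_cen_q iota _ 1); rewrite size_XsubC].
  - split=> [/memC/K0[m' [+ sz irr]]|].
      by rewrite /fstar /tauq => ->; rewrite tau_cen.
    rewrite /fstar /tauq fsE tau_cen => -[sz irr].
    by apply/memC/K0; exists m.
split; first (split; last exact: c1).
  move=> a b; have [_ K1 _ _] := card_proj_roots_fstar iota a b; rewrite memC K1.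
  split=> -[[a0 b0]|[d nz_d fE]]; [by left | right | by left | right]; exists d => //.
    by rewrite /fstar fE cenM !cenXsubC.
  by rewrite cenM !cenXsubC.
split; first (split; last exact: c2).
  move=> a b; have [_ _ K2 _] := card_proj_roots_fstar iota a b; rewrite memC K2; split.
    move=> [d [d' [ne fE]]]; exists (cen iota ('X - d%:P)), (cen iota ('X - d'%:P)).
    rewrite /fstar fE cenM /tauq !tau_cen; split=> //.
    + by split; apply/central_polyP; [exists ('X - d%:P) | exists ('X - d'%:P)].
    + by apply/(size_cen_q iota _ 1); rewrite size_XsubC.
    + by apply/(size_cen_q iota _ 1); rewrite size_XsubC.
    + by rewrite coprimep_XsubC root_XsubC eq_sym.
  move=> [gs [hs [[/central_polyP[s ->] /central_polyP[t ->]]]]].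
  move=> /(size_cen_q iota _ 1) sz_s /(size_cen_q iota _ 1) sz_t.
  rewrite /tauq !tau_cen => co_st fE.
  have [m [mon_m fsE fm]] := min_ab a b.
  have mE : m = s * t.
    by apply: (@cen_inj _ _ iota); rewrite cenM -fsE -fE.
  have [d sE] := size2_XsubC sz_s; have [d' tE] := size2_XsubC sz_t.
  (* [m] is monic, so the leading coefficients of the two linear factors cancel in the product. *)
  have lead_st : lead_coef s * lead_coef t = 1.
    by rewrite -lead_coefM -mE; apply/eqP.
  exists d, d'; split.
    apply: contraTneq co_st => dd; rewrite sE tE dd coprimepZl ?coprimepZr.
    + by rewrite coprimep_XsubC root_XsubC eqxx.
    + by rewrite lead_coef_eq0 -size_poly_eq0 sz_t.
    + by rewrite lead_coef_eq0 -size_poly_eq0 sz_s.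
  by rewrite fsE mE sE tE -scalerAl -scalerAr scalerA lead_st scale1r.
split; first (split; last exact: c3).
  move=> a b; have [_ _ _ K3] := card_proj_roots_fstar iota a b; rewrite memC K3.
  (* The sign changes because x^q + dx corresponds to y - (-d). *)
  split=> -[d nz_d fE]; exists (- d); rewrite ?oppr_eq0 // /fstar.
    by rewrite fE cenXsubC rmorphN scaleNr.
  by rewrite cenXsubC rmorphN scaleNr opprK.
split; first exact: csum.
move=> i ni; apply/setP=> -[a b]; rewrite (mem_collision_set iota) finset.in_set0.
by apply: contraNF ni => /eqP <-; apply: card_proj_roots_cases.
Qed.
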